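(* Let $A\in\mathbb{R}^{n\times n}$ be symmetric positive definite, $f\in\mathbb{R}^n$, and $F\colon\mathbb{R}^n\to\mathbb{R}^n$, $F_i(x)=\phi_i(x_i)$, where each $\phi_i\colon\mathbb{R}\to\mathbb{R}$ is a nondecreasing piecewise $C^2$ function with derivative bounded almost everywhere; let $H(x)=Ax+F(x)-f$. If $\tilde F(x,\varepsilon)$ is an admissible smoothing of $F$, then the Jacobian smoothing Newton algorithm (described in the context) is well defined for solving $H(x)=0$. Moreover, for every initial guess $x^0\in\mathbb{R}^n$ the generated sequence $\{x^k\}$ converges to the unique solution $x^*$ of $H(x)=0$, and the convergence is locally Q-quadratic; that is, unless the algorithm terminates at $x^*$ after finitely many steps, $x^k\to x^*$ and there is a constant $C>0$ such that $\|x^{k+1}-x^*\|\le C\|x^k-x^*\|^2$ for all sufficiently large $k$.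
   Context: Piecewise $C^k$: a continuous function $\phi\colon\mathbb{R}\to\mathbb{R}$ consisting of finitely many $C^k$ pieces, i.e. there are finitely many points $a_1<\dots<a_m$ such that $\phi$ is $C^k$ on each of the closed intervals $(-\infty,a_1],[a_1,a_2],\dots,[a_m,\infty)$. Admissible smoothing: a map $\tilde F\colon\mathbb{R}^n\times(0,\infty)\to\mathbb{R}^n$ with components $\tilde F_i(x,\varepsilon)=\tilde\phi_i(x_i,\varepsilon)$ such that for each $i$: 1. (Smoothness) $\tilde\phi_i(\cdot,\varepsilon)\in C^1(\mathbb{R})$ for all $\varepsilon>0$; 2. (Approximation) there is $\mu>0$ with $|\tilde\phi_i(x_i,\varepsilon)-\phi_i(x_i)|\le\mu\varepsilon$ for all $x_i\in\mathbb{R}$, $\varepsilon>0$; 3. (Monotonicity preservation) $\tilde\phi_i(\cdot,\varepsilon)$ is nondecreasing for all $\varepsilon>0$; 4. (Intermediate slope property) for each $x_i\in\mathbb{R}$ there is $\varepsilon_0>0$ such that for all $0<\varepsilon<\varepsilon_0$ there exist $\delta_1,\delta_2\ge0$ (with $\phi_i$ differentiable at $x_i-\delta_1$ and $x_i+\delta_2$) satisfying $\frac{\partial\tilde\phi_i}{\partial x_i}(x_i,\varepsilon)\in\operatorname{co}\{\phi_i'(x_i-\delta_1),\phi_i'(x_i+\delta_2)\}$ ($\operatorname{co}$ = convex hull); moreover $\delta_1,\delta_2\to0^+$ as $\varepsilon\to0^+$. Notation: $\tilde H(x,\varepsilon)=Ax+\tilde F(x,\varepsilon)-f$; $\tilde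 H'_x$ is its derivative in $x$; $\theta(x)=\frac12\|H(x)\|^2$; $\theta_k(x)=\frac12\|\tilde H(x,\varepsilon^k)\|^2$; $\partial_CH(x)=A+\partial_CF(x)$, where $\partial_CF(x)$ is the set of diagonal matrices $\operatorname{diag}(d_1,\dots,d_n)$ with $d_i\in\operatorname{co}\{\phi_i'(x_i-),\phi_i'(x_i+)\}$, $\phi_i'(x_i\mp)$ being the left and right derivatives; dist is the distance of a matrix to a set in a matrix norm. Jacobian smoothing Newton algorithm. Given constants $\rho,\alpha,\eta\in(0,1)$, $\gamma\in(0,\infty)$ and an initial guess $x^0\in\mathbb{R}^n$, choose $\sigma\in(0,\frac12(1-\alpha))$ and $\mu>0$ such that $\|\tilde H(x,\varepsilon)-H(x)\|\le\mu\varepsilon$ for all $x\in\mathbb{R}^n$, $\varepsilon>0$. Set $\beta_0=\|H(x^0)\|$, $\varepsilon^0=\frac{\alpha}{2\mu}\beta_0$, $k=0$ (if $H(x^0)=0$, then $x^0=x^*$ and the algorithm stops). Iterate: (1) Solve $H(x^k)+\tilde H'_x(x^k,\varepsilon^k)d^k=0$ for $d^k$. (2) Let $m_k$ be the smallest nonnegative integer $m$ satisfying $\theta_k(x^k+\rho^md^k)-\theta_k(x^k)\le-2\sigma\rho^m\theta(x^k)$. Set $t_k=\rho^{m_k}$, $x^{k+1}=x^k+t_kd^k$. (3) If $\|H(x^{k+1})\|=0$, terminate. Otherwise, if $\|H(x^{k+1})\|\le\max\{\eta\beta_k,\alpha^{-1}\|H(x^{k+1})-\tilde H(x^{k+1},\varepsilon^k)\|\}$,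 set $\beta_{k+1}=\|H(x^{k+1})\|$ and choose $\varepsilon^{k+1}$ satisfying $0<\varepsilon^{k+1}\le\min\{\frac{\alpha}{2\mu}\beta_{k+1},\frac{\varepsilon^k}2\}$ and $\operatorname{dist}(\tilde H'_x(x^{k+1},\varepsilon^{k+1}),\partial_CH(x^{k+1}))\le\gamma\beta_{k+1}$; if the inequality is not satisfied, set $\beta_{k+1}=\beta_k$, $\varepsilon^{k+1}=\varepsilon^k$. (4) Set $k\leftarrow k+1$ and return to (1). ''Well defined'' means that each step can be carried out: the linear system in (1) is uniquely solvable, a finite $m_k$ exists in (2), and an admissible $\varepsilon^{k+1}$ exists in (3). *)

(* Defs.v *)
From HB Require Import structures.
From mathcomp Require Import all_boot all_order all_algebra.
From mathcomp Require Import all_classical all_reals all_analysis.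
Set Implicit Arguments.
Unset Strict Implicit.
Unset Printing Implicit Defensive.
Import Order.TTheory GRing.Theory Num.Theory.
Import numFieldNormedType.Exports.
Local Open Scope classical_set_scope.
Local Open Scope ring_scope.

(* R^n is 'cV[R]_n. *)

Section RealFunctions.
Variable R : realType.
Implicit Types (f : R -> R) (D : set R) (s : seq R) (x a b : R).

(* g 0, ..., g k are the successive derivatives of f relative to D, hence
   one-sided derivatives at the endpoints when D is a closed interval. *)
Definition Ck_on (k : nat) D f : Prop :=
  exists g : nat -> R -> R,
    [/\ forall x, D x -> g 0%N x = f x,
        forall j, (j < k)%N -> forall x, D x ->
          (fun y => (g j y - g j x) / (y - x)) @ within D (x^') --> g j.+1 x
      & {within D, continuous (g k)}].

(* pieces -oo [:: a_1; ...; a_m] is the sequence of the closed intervals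
   ]-oo, a_1], [a_1, a_2], ..., [a_m, +oo[. *)
Fixpoint pieces (l : itv_bound R) s : seq (interval R) :=
  if s is a :: s' then Interval l (BRight a) :: pieces (BLeft a) s'
  else [:: Interval l +oo%O].

Definition piecewise_Ck (k : nat) f : Prop :=
  continuous f /\
  exists s, sorted <%R s /\
    forall I, I \in pieces -oo%O s -> Ck_on k [set` I] f.

Definition ae_bounded_derivative f : Prop :=
  exists M : R,
    {ae (@lebesgue_measure R), forall x,
       derivable f x 1 /\ `|f^`()%classic x| <= M}.

Definition left_derivative f x : R :=
  lim ((fun h => h^-1 * (f (x + h) - f x)) @ 0^'-).

Definition right_derivative f x : R :=
  lim ((fun h => h^-1 * (f (x + h) - f x)) @ 0^'+).

(* co {a, b}, with no assumption on the order of a and b *)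
Definition hull2 a b : set R := [set line_path a b t | t in `[0, 1]].

End RealFunctions.

Section Vectors.
Variables (R : realType) (n : nat).

(* The Euclidean norm; the library norm on matrix types is the max norm. *)
Definition norm2 (x : 'cV[R]_n) : R := Num.sqrt (\sum_i x i 0 ^+ 2).

Definition posdefmx (A : 'M[R]_n) : Prop :=
  forall x : 'cV[R]_n, x != 0 -> 0 < (x^T *m A *m x) 0 0.

Definition is_mxnorm (N : 'M[R]_n -> R) : Prop :=
  [/\ forall X Y, N (X + Y) <= N X + N Y,
      forall (a : R) X, N (a *: X) = `|a| * N X
    & forall X, N X = 0 -> X = 0].

Definition mxdist (N : 'M[R]_n -> R) (X : 'M[R]_n) (S : set 'M[R]_n) : R :=
  inf [set N (X - V) | V in S].

(* The matrix of the differential, acting on columns (the library jacobian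
   acts on rows). *)
Definition Jac (G : 'cV[R]_n -> 'cV[R]_n) (x : 'cV[R]_n) : 'M[R]_n :=
  \matrix_(i, j) ('d G x : 'cV[R]_n -> 'cV[R]_n) (delta_mx j 0) i 0.

Definition diag_map (phi : 'I_n -> R -> R) (x : 'cV[R]_n) : 'cV[R]_n :=
  \col_i phi i (x i 0).

Definition residual (A : 'M[R]_n) (F : 'cV[R]_n -> 'cV[R]_n)
    (f x : 'cV[R]_n) : 'cV[R]_n := A *m x + F x - f.

Definition dC_diag (phi : 'I_n -> R -> R) (x : 'cV[R]_n) : set 'M[R]_n :=
  [set diag_mx d | d in [set d : 'rV[R]_n | forall i,
     hull2 (left_derivative (phi i) (x i 0))
           (right_derivative (phi i) (x i 0)) (d 0 i)]].

Definition dC_residual (A : 'M[R]_n) (phi : 'I_n -> R -> R)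
    (x : 'cV[R]_n) : set 'M[R]_n := [set A + V | V in dC_diag phi x].

(* psi is a smoothing of f; the values psi x e with e <= 0 are irrelevant.
   The functions d1 and d2 give delta_1 and delta_2 in terms of e, for a
   fixed x. *)
Definition admissible_smoothing1 (f : R -> R) (psi : R -> R -> R) : Prop :=
  [/\ forall e : R, 0 < e -> (forall x, derivable (psi ^~ e) x 1) /\
        continuous (psi ^~ e)^`()%classic,
      exists2 mu : R, 0 < mu &
        forall x (e : R), 0 < e -> `|psi x e - f x| <= mu * e,
      forall e : R, 0 < e -> {homo psi ^~ e : x y / x <= y}
    & forall x, exists e0 : R, exists d1 d2 : R -> R,
        [/\ 0 < e0,
            forall e : R, 0 < e < e0 ->
              [/\ 0 <= d1 e, 0 <= d2 e,
                  derivable f (x - d1 e) 1, derivable f (x + d2 e) 1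
                & hull2 (f^`()%classic (x - d1 e)) (f^`()%classic (x + d2 e))
                    ((psi ^~ e)^`()%classic x)],
            d1 @ 0^'+ --> (0 : R) & d2 @ 0^'+ --> (0 : R)]].

Definition admissible_smoothing (phi : 'I_n -> R -> R)
    (Ft : 'cV[R]_n -> R -> 'cV[R]_n) : Prop :=
  exists psi : 'I_n -> R -> R -> R,
    (forall x (e : R), 0 < e -> Ft x e = diag_map (fun i t => psi i t e) x) /\
    forall i, admissible_smoothing1 (phi i) (psi i).

End Vectors.

Section Algorithm.
Variable R : realType.

Record params := Params {
  rho : R; alpha : R; eta : R; gamma : R; sigma : R; mu : R }.

Variable n : nat.

Record state := State { iterate : 'cV[R]_n; eps : R; beta : R }.

Variables (H : 'cV[R]_n -> 'cV[R]_n) (Ht : 'cV[R]_n -> R -> 'cV[R]_n).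
Variables (dCH : 'cV[R]_n -> set 'M[R]_n) (N : 'M[R]_n -> R) (p : params).

Implicit Types (s : state) (x y d : 'cV[R]_n) (m : nat) (e : R).

Definition approx_bound c : Prop :=
  0 < c /\ forall x (e : R), 0 < e -> norm2 (Ht x e - H x) <= c * e.

Definition admissible_params : Prop :=
  [/\ [/\ 0 < rho p < 1, 0 < alpha p < 1 & 0 < eta p < 1],
      0 < gamma p, 0 < sigma p < (1 - alpha p) / 2 & approx_bound (mu p)].

Definition theta x : R := norm2 (H x) ^+ 2 / 2.
Definition theta_eps e x : R := norm2 (Ht x e) ^+ 2 / 2.

Definition init_state x0 : state :=
  State x0 (alpha p / (2 * mu p) * norm2 (H x0)) (norm2 (H x0)).

Definition newton_direction s d : Prop :=
  H (iterate s) + Jac (Ht ^~ (eps s)) (iterate s) *m d = 0.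

Definition next_iterate s d m : 'cV[R]_n := iterate s + rho p ^+ m *: d.

Definition sufficient_decrease s d m : bool :=
  theta_eps (eps s) (next_iterate s d m) - theta_eps (eps s) (iterate s)
    <= - 2 * sigma p * rho p ^+ m * theta (iterate s).

Definition is_step_exponent s d m : Prop :=
  sufficient_decrease s d m /\
  forall j, (j < m)%N -> ~~ sufficient_decrease s d j.

Definition update_test s y : bool :=
  norm2 (H y) <= Num.max (eta p * beta s)
                         ((alpha p)^-1 * norm2 (H y - Ht y (eps s))).

Definition admissible_eps s y e : Prop :=
  0 < e <= Num.min (alpha p / (2 * mu p) * norm2 (H y)) (eps s / 2) /\
  mxdist N (Jac (Ht ^~ e) y) (dCH y) <= gamma p * norm2 (H y).

Definition update s s' : Prop :=
  if update_test s (iterate s') then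
    beta s' = norm2 (H (iterate s')) /\ admissible_eps s (iterate s') (eps s')
  else beta s' = beta s /\ eps s' = eps s.

(* The algorithm stops at a state whose iterate is a zero of H: such a state
   has no successor, and its fields eps and beta are irrelevant. *)
Definition step s s' : Prop :=
  H (iterate s) != 0 /\
  exists d m,
    [/\ newton_direction s d, is_step_exponent s d m,
        iterate s' = next_iterate s d m
      & H (iterate s') != 0 -> update s s'].

Inductive reachable x0 : state -> Prop :=
| reachable_init : reachable x0 (init_state x0)
| reachable_step s s' : reachable x0 s -> step s s' -> reachable x0 s'.

Definition well_defined x0 : Prop :=
  forall s, reachable x0 s -> H (iterate s) != 0 ->
    (exists! d, newton_direction s d) /\
    forall d, newton_direction s d ->
      (exists m, is_step_exponent s d m) /\
      forall m, is_step_exponent s d m ->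
        H (next_iterate s d m) != 0 ->
        update_test s (next_iterate s d m) ->
        exists e, admissible_eps s (next_iterate s d m) e.

Definition infinite_run x0 (s_ : nat -> state) : Prop :=
  s_ 0%N = init_state x0 /\ forall k, step (s_ k) (s_ k.+1).

End Algorithm.

(* Main.v *)
Require Import Defs.
From mathcomp Require Import all_boot all_order all_algebra.
From mathcomp Require Import all_classical all_reals all_analysis.
From mathcomp Require Import ring lra.
Set Implicit Arguments.
Unset Strict Implicit.
Unset Printing Implicit Defensive.
Import Order.TTheory GRing.Theory Num.Theory.
Import numFieldNormedType.Exports.
Local Open Scope classical_set_scope.
Local Open Scope ring_scope.

(** Let c > 0 satisfy c |v|^2 <= v . A v (posdefmx_coercive).  Since the phi_i are
    nondecreasing, H is strongly monotone, hence c |x - y| <= |H x - H y|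
    (residual_expansive), and the same bound holds for every matrix A + diag w with
    w >= 0, in particular for the Jacobians of the smoothed residual.  This gives
    uniqueness of the zero and solvability of the Newton systems.  A zero exists
    because |H| has a minimizer, at which a nonzero residual h could be decreased
    by moving along - h (residual_has_zero).

    The algorithm maintains |H x - Ht x eps| <= alpha |H x|.  The squared smoothed
    residual then has along the Newton direction a slope of at most
    - 2 (1 - alpha) |H x|^2, and sigma < (1 - alpha) / 2 leaves room for the line
    search to succeed, with a step length bounded below uniformly on bounded sets
    as long as |H x| stays away from 0 (uniform_sufficient_decrease).  An admissible
    new eps exists because the intermediate slope property pushes the smoothed
    slopes into the hull of the one-sided derivatives
    (smoothing_mxdist_small).

    For global convergence, every update of beta multiplies it by at most
    max(eta, 1/2), and |H (x^k)| <= 2 beta_k throughout.  The updates cannot stop: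
    otherwise eps would be constant, |H| bounded below, the iterates bounded, and
    each step would lower the smoothed residual by a fixed amount (updates_recur).
    So H (x^k) tends to 0, and x^k to the zero xs.

    For the rate, piecewise C2 regularity enters through one estimate
    (slopes_quadratic): |phi y - phi x - v (y - x)| <= C |y - x|^2 for every v in
    the hull of the one-sided derivatives of phi at y.  After an update the smoothed
    Jacobian is within gamma |H x| of the generalized Jacobian, so the full Newton
    step has a quadratic error (newton_step_quadratic).  Near xs this step is
    accepted and triggers the next update, so from then on all steps are of this
    kind (run_quadratic). *)

(** * Euclidean geometry of column vectors *)

Section EuclideanSpace.
Variables (R : realType) (n : nat).
Implicit Types (x y z : 'cV[R]_n).

Definition dot x y : R := \sum_i x i 0 * y i 0.

Lemma dotE x y : dot x y = (x^T *m y) 0 0.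
Proof. by rewrite mxE; apply: eq_bigr => i _; rewrite mxE. Qed.

Lemma dotC x y : dot x y = dot y x.
Proof. by apply: eq_bigr => i _; rewrite mulrC. Qed.

Lemma dotDr x y z : dot x (y + z) = dot x y + dot x z.
Proof. by rewrite -big_split; apply: eq_bigr => i _; rewrite mxE mulrDr. Qed.

Lemma dotZr a x y : dot x (a *: y) = a * dot x y.
Proof. by rewrite mulr_sumr; apply: eq_bigr => i _; rewrite mxE mulrCA. Qed.

Lemma dotNr x y : dot x (- y) = - dot x y.
Proof. by rewrite -scaleN1r dotZr mulN1r. Qed.

Lemma dotDl x y z : dot (x + y) z = dot x z + dot y z.
Proof. by rewrite ![dot _ z]dotC dotDr. Qed.

Lemma dotZl a x y : dot (a *: x) y = a * dot x y.
Proof. by rewrite ![dot _ y]dotC dotZr. Qed.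

Lemma dotNl x y : dot (- x) y = - dot x y.
Proof. by rewrite ![dot _ y]dotC dotNr. Qed.

Lemma norm2_ge0 x : 0 <= norm2 x.
Proof. exact: sqrtr_ge0. Qed.

Lemma sqr_norm2 x : norm2 x ^+ 2 = dot x x.
Proof.
rewrite sqr_sqrtr; first by apply: eq_bigr => i _; rewrite expr2.
by apply: sumr_ge0 => i _; exact: sqr_ge0.
Qed.

Lemma le_norm2 x (b : R) : 0 <= b -> (norm2 x <= b) = (dot x x <= b ^+ 2).
Proof. by move=> b0; rewrite -sqr_norm2 ler_pXn2r// ?nnegrE ?norm2_ge0. Qed.

Lemma abs_coord_le_norm2 x i : `|x i 0| <= norm2 x.
Proof.
rewrite -[leLHS]sqrtr_sqr /norm2 ler_sqrt; last first.
  by apply: sumr_ge0 => j _; exact: sqr_ge0.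
by rewrite (bigD1 i)//= lerDl sumr_ge0// => j _; exact: sqr_ge0.
Qed.

Lemma norm2_eq0 x : (norm2 x == 0) = (x == 0).
Proof.
apply/eqP/eqP => [x0|->]; last first.
  by rewrite /norm2 big1 ?sqrtr0// => i _; rewrite mxE expr0n.
apply/colP => i; rewrite mxE; apply/eqP.
by rewrite -normr_le0 -x0 abs_coord_le_norm2.
Qed.

Lemma norm2_0 : norm2 (0 : 'cV[R]_n) = 0.
Proof. by apply/eqP; rewrite norm2_eq0. Qed.

Lemma norm2_gt0 x : (0 < norm2 x) = (x != 0).
Proof. by rewrite lt_neqAle norm2_ge0 andbT eq_sym norm2_eq0. Qed.

Lemma norm2Z a x : norm2 (a *: x) = `|a| * norm2 x.
Proof.
rewrite /norm2 -sqrtr_sqr -sqrtrM ?sqr_ge0//; congr Num.sqrt.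
by rewrite mulr_sumr; apply: eq_bigr => i _; rewrite mxE exprMn.
Qed.

Lemma norm2N x : norm2 (- x) = norm2 x.
Proof. by rewrite -scaleN1r norm2Z normrN1 mul1r. Qed.

Lemma norm2_distC x y : norm2 (x - y) = norm2 (y - x).
Proof. by rewrite -norm2N opprB. Qed.

(** Expand the squared norm of |y| x - |x| y, which vanishes exactly in the case
    of equality. *)
Lemma cauchy_schwarz x y : dot x y <= norm2 x * norm2 y.
Proof.
have [->|x0] := eqVneq x 0.
  by rewrite norm2_0 mul0r /dot big1// => i _; rewrite mxE mul0r.
have [->|y0] := eqVneq y 0.
  by rewrite norm2_0 mulr0 /dot big1// => i _; rewrite mxE mulr0.
have : 0 <= norm2 (norm2 y *: x - norm2 x *: y) ^+ 2 by exact: sqr_ge0.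
rewrite sqr_norm2 !(dotDl, dotDr, dotNl, dotNr, dotZl, dotZr) (dotC y x).
rewrite -!sqr_norm2.
have a0 : 0 < norm2 x by rewrite norm2_gt0.
have b0 : 0 < norm2 y by rewrite norm2_gt0.
set a := norm2 x in a0 *; set b := norm2 y in b0 *; set d := dot x y => h.
have : 0 <= (2 * (a * b)) * (a * b - d) by move: h; lra.
by rewrite pmulr_rge0 ?mulr_gt0// subr_ge0.
Qed.

Lemma dot_ge_norm2 x y : - (norm2 x * norm2 y) <= dot x y.
Proof. by have := cauchy_schwarz (- x) y; rewrite norm2N dotNl lerNl. Qed.

Lemma sqr_norm2D x y :
  norm2 (x + y) ^+ 2 = norm2 x ^+ 2 + 2 * dot x y + norm2 y ^+ 2.
Proof. by rewrite !sqr_norm2 !(dotDl, dotDr) (dotC y x); ring. Qed.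

Lemma ler_norm2D x y : norm2 (x + y) <= norm2 x + norm2 y.
Proof.
rewrite -(@ler_pXn2r _ 2)// ?nnegrE ?addr_ge0 ?norm2_ge0//.
by rewrite sqr_norm2D; have := cauchy_schwarz x y; lra.
Qed.

Lemma ler_norm2B x y : norm2 (x - y) <= norm2 x + norm2 y.
Proof. by rewrite -(norm2N y) ler_norm2D. Qed.

Lemma norm2_le_distD x y : norm2 x <= norm2 y + norm2 (x - y).
Proof. by have := ler_norm2D y (x - y); rewrite addrC subrK. Qed.

Lemma norm2_le_of_coord x (b : R) : 0 <= b ->
  (forall i, `|x i 0| <= b) -> norm2 x <= n%:R * b.
Proof.
move=> b0 xb; rewrite le_norm2 ?mulr_ge0//.
have [n0|n0] := posnP n.
  by rewrite /dot big1 ?sqr_ge0// => i _; have := ltn_ord i; rewrite {2}n0.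
apply: (@le_trans _ _ (\sum_(i < n) b ^+ 2)).
  apply: ler_sum => i _; rewrite -expr2 -[leLHS]real_normK ?num_real//.
  by rewrite lerXn2r ?nnegrE.
rewrite sumr_const card_ord -[leLHS]mulr_natl exprMn ler_wpM2r ?sqr_ge0//.
by rewrite expr2 ler_peMl// ler1n.
Qed.

(** The topology of matrices comes from the max norm, which the Euclidean norm
    dominates. *)
Lemma cV_cvgP (x_ : nat -> 'cV[R]_n) x :
  norm2 (x_ k - x) @[k --> \oo] --> (0 : R) -> x_ @ \oo --> x.
Proof.
move=> /cvgrPdist_le h; apply/cvgrPdist_le => e e0.
near=> k.
rewrite [leLHS]/Num.Def.normr/= mx_normrE (bigmax_le _ (ltW e0))//= => -[i j] _.
rewrite (ord1 j); apply: le_trans (abs_coord_le_norm2 (x - x_ k) i) _.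
have : `|0 - norm2 (x_ k - x)| <= e by near: k; exact: h.
by rewrite sub0r normrN ger0_norm ?norm2_ge0// norm2_distC.
Unshelve. all: by end_near. Qed.

End EuclideanSpace.

(** * Compactness, coercivity and equivalence of norms *)

Section Compactness.
Variables (R : realType) (n : nat).
Implicit Types (x y z : 'cV[R]_n).

Lemma sum_continuous (T : topologicalType) (I : Type) (r : seq I)
    (F : I -> T -> R) :
  (forall i, continuous (F i)) -> continuous (fun t => \sum_(i <- r) F i t).
Proof.
move=> cF; apply: (@continuous_big _ _ _ _ _ _ T r F) => //.
exact: add_continuous.
Qed.

Lemma continuous_coords (T : topologicalType) (m p : nat)
    (g : T -> 'M[R]_(m, p)) :
  (forall i j, continuous (fun t => g t i j)) -> continuous g.
Proof.
move=> cg t; apply/cvgrPdist_le => e e0; near=> u.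
rewrite [leLHS]/Num.Def.normr/= mx_normrE (bigmax_le _ (ltW e0))//= => k _.
rewrite !mxE; move: k; near: u; apply: filter_forall => k.
exact: ((cvgrPdist_le _ _).1 (cg k.1 k.2 t)).
Unshelve. all: by end_near. Qed.

Lemma continuous_norm2 : continuous (@norm2 R n).
Proof.
move=> x; apply: (@continuous_comp _ _ _ (fun x : 'cV[R]_n =>
  \sum_i x i 0 ^+ 2) (@Num.sqrt R)); last exact: sqrt_continuous.
apply: sum_continuous => i y.
apply: (@continuous_comp _ _ _ (fun x : 'cV[R]_n => x i 0) (fun t => t ^+ 2)).
  exact: coord_continuous.
exact: exprn_continuous.
Qed.

Lemma continuous_dot (T : topologicalType) (g h : T -> 'cV[R]_n) :
  continuous g -> continuous h -> continuous (fun t => dot (g t) (h t)).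
Proof.
have coord (k : T -> 'cV[R]_n) i : continuous k -> continuous (fun t => k t i 0).
  move=> ck t; apply: (@continuous_comp _ _ _ k (fun x : 'cV[R]_n => x i 0)).
    exact: ck.
  exact: coord_continuous.
by move=> cg ch; apply: sum_continuous => i t; apply: cvgM; exact: coord.
Qed.

(** Heine-Borel holds for row vectors; it is carried over by transposition. *)
Lemma compact_norm2_ball (B : R) : compact [set x : 'cV[R]_n | norm2 x <= B].
Proof.
pose K := [set v : 'rV[R]_n | norm2 v^T <= B].
have ctr : continuous (fun v : 'rV[R]_n => v^T).
  apply: continuous_coords => i j.
  rewrite (_ : (fun _ => _) = (fun v : 'rV[R]_n => v j i)).
    exact: coord_continuous.
  by apply/funext => v; rewrite mxE.
have cK : compact K.
  apply: bounded_closed_compact.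
    exists B; split=> [|M BM v /= vK]; first exact: num_real.
    rewrite /Num.Def.normr/= mx_normrE bigmax_le//.
      by rewrite (le_trans _ (ltW BM))// (le_trans _ vK)// norm2_ge0.
    move=> [i j] _ /=; rewrite ord1 (le_trans _ (ltW BM))// (le_trans _ vK)//.
    by rewrite (le_trans _ (abs_coord_le_norm2 _ j))// mxE.
  apply: (@preimage_closed _ _ (fun v : 'rV[R]_n => norm2 v^T)
            [set t | t <= B]); last exact: closed_le.
  move=> v _; apply: (@continuous_comp _ _ _ (fun v : 'rV[R]_n => v^T)).
    exact: ctr.
  exact: continuous_norm2.
rewrite (_ : mkset _ = (fun v : 'rV[R]_n => v^T) @` K).
  by apply: continuous_compact => //; exact: continuous_subspaceT.
apply/seteqP; split=> [x xB|_ [v vK <-]//]; exists x^T; last exact: trmxK.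
by rewrite /K/= trmxK.
Qed.

(** The use of compactness behind both equivalence of norms and uniform positive
    definiteness: a continuous function attains its minimum on the
    sphere.  In dimension 0 the sphere is empty and any constant works. *)
Lemma positive_on_sphere (q : 'cV[R]_n -> R) : continuous q ->
  (forall x, x != 0 -> 0 < q x) ->
  exists2 c : R, 0 < c & forall x, norm2 x = 1 -> c <= q x.
Proof.
move=> cq q0; pose S := [set x : 'cV[R]_n | norm2 x = 1].
have [[x0 x0S]|S0] := pselect (S !=set0); last first.
  by exists 1 => // x x1; exfalso; apply: S0; exists x.
have cS : compact S.
  have SB : S `<=` [set x : 'cV[R]_n | norm2 x <= 1] by move=> x; rewrite /S/= => ->.
  apply: (fun cS => subclosed_compact cS (@compact_norm2_ball 1) SB).
  apply: (@preimage_closed _ _ (@norm2 R n) [set 1]); last exact: closed_eq.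
  by move=> x _; exact: continuous_norm2.
have [|x xS xmin] := @compact_EVT_min _ R q S (ex_intro _ _ x0S) cS.
  exact: continuous_subspaceT.
exists (q x); last by move=> y yS; apply: xmin; rewrite inE.
apply: q0; rewrite -norm2_gt0; move: xS; rewrite inE => ->.
exact: ltr01.
Qed.

Lemma continuous_mulmx (A : 'M[R]_n) : continuous (fun x : 'cV[R]_n => A *m x).
Proof.
apply: continuous_coords => i j.
rewrite (_ : (fun _ => _) = (fun x : 'cV[R]_n => \sum_k A i k * x k j)).
  apply: sum_continuous => k x.
  apply: (@continuousM _ _ (cst (A i k)) (fun x : 'cV[R]_n => x k j)).
    exact: cst_continuous.
  exact: coord_continuous.
by apply/funext => x; rewrite mxE.
Qed.

Lemma posdefmx_coercive (A : 'M[R]_n) : posdefmx A ->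
  exists2 c : R, 0 < c & forall x, c * norm2 x ^+ 2 <= dot x (A *m x).
Proof.
move=> posA.
have [||c c0 Ac] := @positive_on_sphere (fun x => dot x (A *m x)).
- by apply: continuous_dot => [x|] //; exact: continuous_mulmx.
- by move=> x x0; rewrite dotE mulmxA; exact: posA.
exists c => // x; have [->|x0] := eqVneq x 0.
  by rewrite mulmx0 -sqr_norm2 norm2_0 expr0n mulr0.
have nx : 0 < norm2 x by rewrite norm2_gt0.
have := Ac ((norm2 x)^-1 *: x).
rewrite norm2Z ger0_norm ?invr_ge0 ?norm2_ge0// mulVf ?gt_eqF// => /(_ erefl).
rewrite -scalemxAr dotZl dotZr mulrA -invfM -expr2 mulrC.
by rewrite ler_pdivlMr ?exprn_gt0.
Qed.

End Compactness.

Section MatrixNorm.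
Variables (R : realType) (n : nat) (N : 'M[R]_n -> R).
Hypothesis normN : is_mxnorm N.

Lemma mxnorm0 : N 0 = 0.
Proof. by case: normN => _ NZ _; rewrite -(scale0r 0) NZ normr0 mul0r. Qed.

Lemma mxnormN X : N (- X) = N X.
Proof. by case: normN => _ NZ _; rewrite -scaleN1r NZ normrN1 mul1r. Qed.

Lemma mxnorm_ge0 X : 0 <= N X.
Proof.
case: normN => ND _ _; have := ND X (- X).
by rewrite subrr mxnorm0 mxnormN -mulr2n pmulrn_lge0.
Qed.

Lemma mxnorm_sum (I : Type) (r : seq I) (X : I -> 'M[R]_n) :
  N (\sum_(i <- r) X i) <= \sum_(i <- r) N (X i).
Proof.
case: normN => ND _ _.
elim/big_ind2 : _ => [|a b c d h k|//]; first by rewrite mxnorm0.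
by apply: le_trans (ND _ _) _; exact: lerD.
Qed.

Lemma mxnorm_diag_le : exists2 K : R, 0 < K & forall (d : 'rV[R]_n) (b : R),
  0 <= b -> (forall i, `|d 0 i| <= b) -> N (diag_mx d) <= K * b.
Proof.
case: (normN) => _ NZ _.
exists (1 + \sum_i N (delta_mx i i)).
  by rewrite ltr_pwDl// sumr_ge0// => i _; exact: mxnorm_ge0.
move=> d b b0 db; rewrite diag_mx_sum_delta.
apply: le_trans (mxnorm_sum _ _) _.
rewrite mulrDl mul1r mulr_suml; apply: ler_wpDl => //.
by apply: ler_sum => i _; rewrite NZ mulrC ler_wpM2l ?mxnorm_ge0.
Qed.

(** Two norms on a finite-dimensional space are equivalent.  Only differences of
    two matrices A + diag d occur, so diagonal matrices suffice. *)
Lemma mxnorm_diag_ge : exists2 c : R, 0 < c & forall (d : 'rV[R]_n) i,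
  c * `|d 0 i| <= N (diag_mx d).
Proof.
case: (normN) => ND NZ N0.
have [K K0 NK] := mxnorm_diag_le.
pose q (x : 'cV[R]_n) := N (diag_mx x^T).
have qB x y : q x <= q y + q (x - y).
  rewrite /q; apply: le_trans (ND _ _).
  by rewrite -raddfD -raddfD/= addrC subrK.
have [||c c0 qc] := @positive_on_sphere _ _ q.
- move=> x; apply/(@cvgrPdist_le _ _ _ (nbhs x) (nbhs_filter x)) => e e0.
  near=> y.
  have h : K * `|x - y| <= e.
    rewrite mulrC -ler_pdivlMr//; near: y.
    apply: filterS (nbhsx_ballx x (e / K) (divr_gt0 e0 K0)) => z.
    by rewrite mx_norm_ball/ball_/= => /ltW.
  have qd z : q z <= K * `|z|.
    apply: NK => // i; rewrite mxE [leRHS]/Num.Def.normr/= mx_normrE.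
    exact: (@le_bigmax _ _ _ _ (fun k : 'I_n * 'I_1 => `|z k.1 k.2|) (i, 0)).
  have h1 := le_trans (qd (x - y)) h.
  have h2 : q (y - x) <= e by rewrite (le_trans (qd _))// -normrN opprB.
  have := qB x y; have := qB y x; rewrite ler_distl; lra.
- move=> x x0; rewrite lt_neqAle mxnorm_ge0 andbT eq_sym.
  apply: contra x0 => /eqP /N0 /matrixP x0; apply/eqP/colP => i.
  by have := x0 i i; rewrite !mxE eqxx.
exists c => // d i; have [d0|d0] := eqVneq d^T 0.
  by rewrite -[d]trmxK d0 !mxE normr0 mulr0 mxnorm_ge0.
have nd : 0 < norm2 d^T by rewrite norm2_gt0.
have := qc ((norm2 d^T)^-1 *: d^T).
rewrite norm2Z ger0_norm ?invr_ge0 ?norm2_ge0// mulVf ?gt_eqF// => /(_ erefl).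
rewrite /q linearZ/= linearZ/= NZ trmxK ger0_norm ?invr_ge0 ?norm2_ge0//.
rewrite mulrC ler_pdivlMr// => h; apply: le_trans h.
by rewrite ler_pM2l// (le_trans _ (abs_coord_le_norm2 _ i))// mxE.
Unshelve. all: by end_near. Qed.

End MatrixNorm.

(** * Local structure of piecewise C2 functions *)

Section PiecewiseC2.
Variable R : realType.
Implicit Types (f : R -> R) (D : set R) (x y a b d K : R).

(** Every point has a piece that contains a whole right neighbourhood of it; at a
    breakpoint this is the piece that starts there. *)
Lemma pieces_right (l : itv_bound R) (s : seq R) x : (l <= BLeft x)%O ->
  exists2 I, I \in pieces l s &
    exists2 d, 0 < d & forall y, x <= y < x + d -> y \in I.
Proof.
elim: s l => [|a s IH] l lx /=.
  exists (Interval l +oo%O); first by rewrite inE.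
  exists 1 => // y /andP[xy _]; rewrite itv_boundlr.
  by rewrite (le_trans lx) ?bnd_simp.
have [xa|ax] := ltP x a.
  exists (Interval l (BRight a)); first by rewrite inE eqxx.
  exists (a - x); first by rewrite subr_gt0.
  move=> y /andP[xy]; rewrite addrC subrK => ya.
  by rewrite itv_boundlr (le_trans lx)//= bnd_simp// ltW.
have [|I Is Ix] := IH (BLeft a); first by rewrite bnd_simp.
by exists I => //; rewrite inE Is orbT.
Qed.

(** The mirror image of the previous lemma: at a breakpoint the piece that ends
    there is needed, so the left end l has to lie strictly below x, which is
    what e expresses. *)
Lemma pieces_left (l : itv_bound R) (s : seq R) x e :
  0 < e -> (l <= BLeft (x - e))%O ->
  exists2 I, I \in pieces l s &
    exists2 d, 0 < d & forall y, x - d < y <= x -> y \in I.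
Proof.
elim: s l e => [|a s IH] l e e0 lx /=.
  exists (Interval l +oo%O); first by rewrite inE.
  exists e => // y /andP[xy _]; rewrite itv_boundlr.
  by rewrite (le_trans lx) ?bnd_simp// ltW.
have [xa|ax] := leP x a.
  exists (Interval l (BRight a)); first by rewrite inE eqxx.
  exists e => // y /andP[xy yx].
  rewrite itv_boundlr (le_trans lx)//= bnd_simp ?(le_trans yx)//.
  by rewrite ltW.
have [||I Is Ix] := IH (BLeft a) (x - a); first by rewrite subr_gt0.
  by rewrite bnd_simp opprB addrC subrK.
by exists I => //; rewrite inE Is orbT.
Qed.

Lemma within_dnbhsP (g : R -> R) D x l :
  g @ within D (x^') --> l -> forall e, 0 < e ->
  exists2 r, 0 < r & forall y, D y -> 0 < `|y - x| < r -> `|l - g y| <= e.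
Proof.
move=> /cvgrPdist_le gl e e0; have := gl e e0.
move=> /nbhs_ballP[r r0 h]; exists r => // y Dy /andP[yx0 yxr].
apply: h => //; first by rewrite /ball/= distrC.
by apply/eqP => yx; move: yx0; rewrite yx subrr normr0 ltxx.
Qed.

(** The second derivative is used only through its value at x: a function with a
    derivative relative to D at x differs from its value at x by at most a
    multiple of |y - x|, and here that function is the first derivative.  At
    points interior to D the relative derivative is the ordinary one. *)
Lemma Ck_on_slope f D x : Ck_on 2 D f -> D x ->
  exists a K d, 0 < d /\ forall y, 0 < `|y - x| < d -> nbhs y D ->
    derivable f y 1 /\ `|f^`()%classic y - a| <= K * `|y - x|.
Proof.
move=> [g [g0 gd _]] Dx.
have [d d0 gx] := within_dnbhsP (gd 1%N isT x Dx) ltr01.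
exists (g 1%N x), (`|g 2%N x| + 1), d; split => // y yx Dy.
have Dy' : D y by exact: nbhs_singleton.
have fy : h^-1 *: (f (h *: 1 + y) - f y) @[h --> 0^'] --> g 1%N y.
  apply/cvgrPdist_le => e e0.
  have [r r0 gy] := within_dnbhsP (gd 0%N isT y Dy') e0.
  move/nbhs_ballP : Dy => [r' r'0 Dy].
  near=> h.
  have h0 : h != 0 by near: h; exact: nbhs_dnbhs_neq.
  have hr : `|h| < Num.min r r'.
    by near: h; apply: dnbhs0_lt; rewrite lt_min r0.
  have Dh : D (h *: 1 + y).
    apply: Dy; rewrite /ball/= scaler1 opprD addrCA subrr addr0 normrN.
    by move: hr; rewrite lt_min => /andP[].
  have := gy (h *: 1 + y) Dh; rewrite !g0//.
  have -> : h *: 1 + y - y = h by rewrite scaler1 addrK.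
  rewrite normr_gt0 h0/= (lt_le_trans hr) ?ge_min ?lexx// => /(_ isT).
  by rewrite [_ *: (_ - _)]mulrC.
have f'y : f^`()%classic y = g 1%N y by rewrite derive1E; exact: cvg_lim.
split; first by apply/cvg_ex; exists (g 1%N y).
have yx0 : 0 < `|y - x| by case/andP: yx.
rewrite f'y -ler_pdivrMr// -normf_div.
set q := _ / _; set l := g 2%N x; have : `|l - q| <= 1 := gx y Dy' yx.
by have := ler_normB l (l - q); rewrite subKr; lra.
Unshelve. all: by end_near. Qed.

(** What piecewise C2 means at one point, breakpoint or not: f is differentiable
    near x except possibly at x, and the derivative stays within K |y - x| of a
    on the left and of b on the right.  If f is continuous, a and b are then its
    one-sided derivatives at x. *)
Definition one_sided_slopes f x a b K d : Prop :=
  0 < d /\ forall y, 0 < `|y - x| < d ->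
    derivable f y 1 /\
    `|f^`()%classic y - (if y < x then a else b)| <= K * `|y - x|.

Lemma piecewise_C2_slopes f x : piecewise_Ck 2 f ->
  exists a b K d, 0 <= K /\ one_sided_slopes f x a b K d.
Proof.
move=> [_ [s [_ fs]]].
have [I Is [d1 d10 xI]] := @pieces_left -oo%O s x 1 ltr01 isT.
have [J Js [d2 d20 xJ]] := @pieces_right -oo%O s x isT.
have [|a [K1 [e1 [e10 h1]]]] := @Ck_on_slope _ _ x (fs _ Is).
  by apply: xI; rewrite lexx andbT ltrBlDr ltrDl.
have [|b [K2 [e2 [e20 h2]]]] := @Ck_on_slope _ _ x (fs _ Js).
  by apply: xJ; rewrite lexx ltrDl.
exists a, b, (`|K1| + `|K2|), (Num.min (Num.min d1 e1) (Num.min d2 e2)).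
split; first exact: addr_ge0.
split; first by rewrite !lt_min d10 e10 d20.
move=> y /andP[yx0]; rewrite !lt_min => /andP[/andP[yd1 ye1] /andP[yd2 ye2]].
case: ltgtP => [yx|xy|yx]; last first.
- by move: yx0; rewrite yx subrr normr0 ltxx.
- have [||] := h2 y; first by rewrite yx0.
    rewrite ger0_norm ?subr_ge0 ?(ltW xy)// in yd2.
    have : nbhs y `]x, x + d2[%classic.
      by apply: near_in_itvoo; rewrite in_itv/= xy -ltrBlDl.
    apply: filterS => z /=; rewrite in_itv/= => /andP[xz zd].
    by apply: xJ; rewrite ltW.
  move=> fy h; split=> //; apply: le_trans h _; apply: ler_wpM2r => //.
  by rewrite (le_trans (ler_norm _))// lerDr.
- have [||] := h1 y; first by rewrite yx0.
    rewrite distrC ger0_norm ?subr_ge0 ?(ltW yx)// in yd1.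
    have : nbhs y `]x - d1, x[%classic.
      by apply: near_in_itvoo; rewrite in_itv/= yx andbT ltrBlDr -ltrBlDl.
    apply: filterS => z /=; rewrite in_itv/= => /andP[xz zd].
    by apply: xI; rewrite xz ltW.
  move=> fy h; split=> //; apply: le_trans h _; apply: ler_wpM2r => //.
  by rewrite (le_trans (ler_norm _))// lerDl.
Qed.

End PiecewiseC2.

Section OneSidedSlopes.
Variable R : realType.
Implicit Types (f : R -> R) (x y a b d K : R).

(** The mean value theorem on whichever side of x the point y lies, with f allowed
    to have a kink at x itself. *)
Lemma mean_value f x y : continuous f -> y != x ->
  (forall z, 0 < `|z - x| < `|y - x| -> derivable f z 1) ->
  exists z, [/\ 0 < `|z - x| < `|y - x|, (z < x) = (y < x)
    & f y - f x = f^`()%classic z * (y - x)].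
Proof.
move=> cf; rewrite neq_lt => /orP[yx|xy] fd.
- have dz z : z \in `]y, x[ -> 0 < `|z - x| < `|y - x|.
    rewrite in_itv/= => /andP[yz zx].
    rewrite !ltr0_norm ?subr_lt0// oppr_gt0 subr_lt0 zx/=.
    by rewrite ltrN2 ltrD2r.
  have [||z zyx fz] := @MVT _ f f^`()%classic y x yx.
  + by move=> z /dz /fd; rewrite derive1E => /derivableP.
  + exact: continuous_subspaceT.
  exists z; split; first exact: dz.
    by rewrite yx; move: zyx; rewrite in_itv/= => /andP[].
  by rewrite -opprB fz; ring.
- have dz z : z \in `]x, y[ -> 0 < `|z - x| < `|y - x|.
    rewrite in_itv/= => /andP[yz zx].
    by rewrite !gtr0_norm ?subr_gt0// yz/= ltrD2r.
  have [||z zyx fz] := @MVT _ f f^`()%classic x y xy.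
  + by move=> z /dz /fd; rewrite derive1E => /derivableP.
  + exact: continuous_subspaceT.
  exists z; split => //; first exact: dz.
  move: zyx; rewrite in_itv/= => /andP[xz _].
  by rewrite !ltNge (ltW xz) (ltW xy).
Qed.

Lemma one_sided_derivatives f x : derivable f x 1 ->
  left_derivative f x = f^`()%classic x /\
  right_derivative f x = f^`()%classic x.
Proof.
move=> /derivableP[/cvg_ex[l fl] _].
have fl' : h^-1 * (f (x + h) - f x) @[h --> 0^'] --> l.
  rewrite (_ : (fun h => h^-1 * (f (x + h) - f x)) =
    (fun h => h^-1 *: (f (h *: 1 + x) - f x))); first exact: fl.
  by apply/funext => h; rewrite scaler1 (addrC h).
have -> : f^`()%classic x = l by rewrite derive1E; exact: cvg_lim.
split; apply: cvg_lim => //.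
  exact: (cvg_dnbhs_at_left fl').
exact: (cvg_dnbhs_at_right fl').
Qed.

(** The difference quotient between x and y is a derivative at an intermediate
    point on the same side of x, hence also close to a or b. *)
Lemma slopes_mean_value f x a b K d y :
  continuous f -> one_sided_slopes f x a b K d -> 0 < `|y - x| < d ->
  exists2 v, f y - f x = v * (y - x) &
    `|v - (if y < x then a else b)| <= K * `|y - x| /\ 0 <= K.
Proof.
move=> cf [_ S] /andP[yx0 yxd].
have K0 : 0 <= K.
  have [_ h] := S y (introT andP (conj yx0 yxd)).
  by move: (le_trans (normr_ge0 _) h); rewrite pmulr_lge0.
have [||z [/andP[z0 zy] sz fz]] := @mean_value f x y cf.
- by apply/eqP => yx; move: yx0; rewrite yx subrr normr0 ltxx.
- by move=> z /andP[z0 zy]; have [] := S z; rewrite ?z0 ?(lt_trans zy).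
exists (f^`()%classic z) => //; split => //.
have [|_ h] := S z; first by rewrite z0 (lt_trans zy).
by rewrite -sz (le_trans h)// ler_wpM2l// ltW.
Qed.

Lemma slopes_one_sided_derivatives f x a b K d :
  continuous f -> one_sided_slopes f x a b K d ->
  left_derivative f x = a /\ right_derivative f x = b.
Proof.
move=> cf S; have [d0 _] := S.
have quot (h : R) : 0 < `|h| < d ->
    `|(if h < 0 then a else b) - h^-1 * (f (x + h) - f x)| <= K * `|h|.
  move=> hd; have [|v] := slopes_mean_value (y := x + h) cf S.
    by rewrite (addrC x) addrK.
  rewrite (addrC x) addrK => -> [h1 _].
  have h0 : h != 0 by rewrite -normr_gt0; case/andP: hd.
  by rewrite mulrCA mulVf// mulr1 distrC -ltrBrDr subrr in h1 *.
have small e : 0 < e -> exists2 r, 0 < r & forall h : R,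
    0 < `|h| < r -> 0 < `|h| < d /\ K * `|h| <= e.
  move=> e0; exists (Num.min d (e / (`|K| + 1))).
    by rewrite lt_min d0 divr_gt0// ltr_wpDl.
  move=> h /andP[h0]; rewrite lt_min h0 => /andP[hd].
  rewrite ltr_pdivlMr ?ltr_wpDl// => he; split => //.
  by have := ler_norm K; nra.
split; apply: cvg_lim => //; apply/cvgrPdist_le => e e0;
  have [r r0 hr] := small e e0; near=> h.
- have h0 : h < 0 by near: h; exact: nbhs_left_lt.
  have [|hd he] := hr h.
    rewrite ltr0_norm// oppr_gt0 h0/= ltrNl; near: h.
    by apply: nbhs_left_gt; rewrite oppr_lt0.
  by apply: le_trans he; have := quot h hd; rewrite h0.
- have h0 : 0 < h by near: h; exact: nbhs_right_gt.
  have [|hd he] := hr h.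
    by rewrite gtr0_norm// h0/=; near: h; exact: nbhs_right_lt.
  by apply: le_trans he; have := quot h hd; rewrite ltNge (ltW h0).
Unshelve. all: by end_near. Qed.

Lemma slopes_calm f x a b K d y :
  continuous f -> one_sided_slopes f x a b K d -> `|y - x| < d ->
  `|f y - f x| <= (`|a| + `|b| + `|K| * d) * `|y - x|.
Proof.
move=> cf S yd; have [->|yx] := eqVneq y x; first by rewrite !subrr normr0 mulr0.
have yx0 : 0 < `|y - x| by rewrite normr_gt0 subr_eq0.
have [|v -> [h K0]] := slopes_mean_value (y := y) cf S; first by rewrite yx0.
rewrite normrM ler_wpM2r//.
set c := (X in v - X) in h.
have hc : `|c| <= `|a| + `|b| by rewrite /c; case: ifP => _; rewrite ?lerDl ?lerDr.
have := ler_normD (v - c) c; rewrite subrK (ger0_norm K0).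
have : K * `|y - x| <= K * d by rewrite ler_wpM2l// ltW.
by lra.
Qed.

Lemma line_path_dist a b a' b' t e : 0 <= t <= 1 ->
  `|a - a'| <= e -> `|b - b'| <= e ->
  `|line_path a b t - line_path a' b' t| <= e.
Proof.
move=> /andP[t0 t1] ha hb; rewrite /line_path.
rewrite (_ : _ - _ = (1 - t) * (a - a') + t * (b - b')); last by ring.
apply: le_trans (ler_normD _ _) _; rewrite !normrM (ger0_norm t0).
by rewrite ger0_norm ?subr_ge0//; nra.
Qed.

(** The estimate that makes Newton steps quadratic.  For y different from x the
    hull is the single number f'(y); both f'(y) and the difference quotient lie
    within K |y - x| of the same one-sided slope. *)
Lemma slopes_quadratic f x a b K d y v :
  continuous f -> one_sided_slopes f x a b K d -> `|y - x| < d ->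
  hull2 (left_derivative f y) (right_derivative f y) v ->
  `|f y - f x - v * (y - x)| <= 2 * `|K| * `|y - x| ^+ 2.
Proof.
move=> cf S yd; have [->|yx] := eqVneq y x.
  by move=> _; rewrite !subrr mulr0 subrr normr0 expr0n mulr0.
have yx0 : 0 < `|y - x| by rewrite normr_gt0 subr_eq0.
have yxd : 0 < `|y - x| < d by rewrite yx0.
have [_ S'] := S; have [fy hy] := S' y yxd.
have [-> ->] := one_sided_derivatives fy.
move=> [t _]; rewrite line_path_flat /cst => <-{v}.
have [|w -> [h K0]] := slopes_mean_value (y := y) cf S; first by rewrite yx0.
rewrite -mulrBl normrM expr2 mulrA ler_wpM2r// (ger0_norm K0).
set c := (X in w - X) in h hy.
have := ler_normB (w - c) (f^`()%classic y - c).
by rewrite opprB addrA subrK; lra.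
Qed.

(** The intermediate slope property places the smoothed slope in the hull of f' at
    x - d1 and x + d2, which tend to x.  The derivatives there tend to the
    one-sided slopes a and b, and the same convex combination of a and b is the
    required element. *)
Lemma smoothing_slope_near_hull f (psi : R -> R -> R) x a b K d w :
  continuous f -> one_sided_slopes f x a b K d ->
  admissible_smoothing1 f psi -> 0 < w ->
  exists2 e1, 0 < e1 & forall e, 0 < e < e1 ->
    exists2 v, hull2 (left_derivative f x) (right_derivative f x) v &
      `|(psi ^~ e)^`()%classic x - v| <= w.
Proof.
move=> cf S [_ _ _ /(_ x)[e0 [d1 [d2 [e00 slope c1 c2]]]]] w0.
have [fa fb] := slopes_one_sided_derivatives cf S.
have [d0 S'] := S.
pose r := Num.min d (w / (`|K| + 1)).
have r0 : 0 < r by rewrite lt_min d0 divr_gt0// ltr_wpDl.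
have near_slope y : `|y - x| < r -> y != x -> derivable f y 1 ->
    `|f^`()%classic y - (if y < x then a else b)| <= w.
  rewrite lt_min => /andP[yd]; rewrite ltr_pdivlMr ?ltr_wpDl// => yw yx fy.
  have yx0 : 0 < `|y - x| by rewrite normr_gt0 subr_eq0.
  have [|_ h] := S' y; first by rewrite yx0.
  by apply: le_trans h _; have := ler_norm K; nra.
have : \forall e \near 0^'+, [/\ `|d1 e| < r, `|d2 e| < r & 0 < e < e0].
  near=> e; split.
  - by near: e; exact: (cvgr0_norm_lt _ c1).
  - by near: e; exact: (cvgr0_norm_lt _ c2).
  - apply/andP; split; near: e; first exact: nbhs_right_gt.
    exact: nbhs_right_lt.
move=> [e1 e10 he]; exists e1 => // e /andP[egt0 ee1].
have [||h1 h2 ee0] := he e; rewrite /= ?sub0r ?normrN ?gtr0_norm//.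
have [d10 d20 fd1 fd2 [t t01 <-]] := slope e ee0.
exists (line_path a b t); first by rewrite fa fb; exists t.
have t01' : 0 <= t <= 1 by move: t01; rewrite /= in_itv.
apply: line_path_dist => //.
- (* If d1 e = 0 then f is differentiable at x, so its derivative there is a. *)
  have [d1z|d1z] := eqVneq (d1 e) 0.
    move: fd1; rewrite d1z subr0 => /one_sided_derivatives[<- _].
    by rewrite fa subrr normr0 ltW.
  have := near_slope (x - d1 e); rewrite addrAC subrr sub0r normrN.
  have d1p : 0 < d1 e by rewrite lt_neqAle eq_sym d1z.
  rewrite ltrBlDr ltrDl d1p; apply => //.
  by rewrite -subr_eq0 addrAC subrr sub0r oppr_eq0.
- have [d2z|d2z] := eqVneq (d2 e) 0.
    move: fd2; rewrite d2z addr0 => /one_sided_derivatives[_ <-].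
    by rewrite fb subrr normr0 ltW.
  have := near_slope (x + d2 e); rewrite addrAC subrr add0r.
  rewrite gtrDl (ltNge _ 0) d20/=; apply => //.
  by rewrite -subr_eq0 addrAC subrr add0r.
Unshelve. all: by end_near. Qed.

Lemma nondecreasing_derive1_ge0 f x : {homo f : y z / y <= z} ->
  derivable f x 1 -> 0 <= f^`()%classic x.
Proof.
move=> mf fx; rewrite derive1E; apply: limr_ge; first exact: fx.
near=> h.
have h0 : h != 0 by near: h; exact: nbhs_dnbhs_neq.
rewrite scaler1; move: h0; rewrite neq_lt => /orP[h0|h0].
  by apply: mulr_le0; rewrite ?invr_le0 ?subr_le0 ?mf ?gerDr ?ltW.
by apply: mulr_ge0; rewrite ?invr_ge0 ?subr_ge0 ?mf ?lerDr ?ltW.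
Unshelve. all: by end_near. Qed.

(** Uniform continuity of f' on a compact interval, obtained directly from the
    covering characterization of compactness, together with the mean value
    theorem. *)
Lemma uniform_first_order f B w : (forall x, derivable f x 1) ->
  continuous f^`()%classic -> 0 < w ->
  exists2 r, 0 < r & forall x h, `|x| <= B -> `|h| < r ->
    `|f (x + h) - f x - f^`()%classic x * h| <= w * `|h|.
Proof.
move=> df cf' w0.
have cf : continuous f by move=> x; apply/differentiable_continuous/derivable1_diffP.
pose P (r x : R) := forall h, `|h| < r ->
    `|f (x + h) - f x - f^`()%classic x * h| <= w * `|h|.
have cov : near_covering `[- B, B].
  by apply/compact_near_coveringP; exact: segment_compact.
have /nbhs_ballP : \forall r \near 0^'+, `[- B, B] `<=` P r.
  apply: cov => x _.
  have : \forall y \near x, `|f^`()%classic x - f^`()%classic y| <= w / 2.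
    have /(@cvgrPdist_le _ _ _ (nbhs x)) := cf' x; apply.
    exact: divr_gt0.
  move=> /nbhs_ballP[r /= r0 hr].
  exists (ball x (r / 2), [set s | 0 < s < r / 2]).
    split; first by apply: nbhsx_ballx; exact: divr_gt0.
    near=> s; apply/andP; split; near: s; first exact: nbhs_right_gt.
    by apply: nbhs_right_lt; exact: divr_gt0.
  move=> [y s] /= [xy /andP[s0 sr]] h hs.
  have [->|h0] := eqVneq h 0; first by rewrite addr0 subrr mulr0 subrr !normr0 mulr0.
  have yhy : y + h - y = h by rewrite addrAC subrr add0r.
  have [||z [/andP[z0 zh] _ ->]] := @mean_value f y (y + h) cf.
  - by rewrite -subr_eq0 yhy.
  - by [].
  rewrite yhy in zh *; rewrite -mulrBl normrM ler_wpM2r//.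
  have h1 : `|f^`()%classic x - f^`()%classic y| <= w / 2.
    apply: hr; rewrite /ball/= in xy *; rewrite (lt_le_trans xy)//.
    by rewrite ler_pdivrMr// ler_pMr// ler1n.
  have h2 : `|f^`()%classic x - f^`()%classic z| <= w / 2.
    apply: hr; rewrite /ball/= in xy *.
    have := ler_distD y x z; rewrite (distrC y z); lra.
  by have := ler_distD (f^`()%classic x) (f^`()%classic z) (f^`()%classic y);
     rewrite (distrC _ (f^`()%classic x)); lra.
move=> [r /= r0 hr]; exists (r / 2); first exact: divr_gt0.
move=> x h xB hr2; apply: (hr (r / 2)) => //.
- by rewrite /ball/= sub0r normrN gtr0_norm ?divr_gt0// ltr_pdivrMr// ltr_pMr// ltr1n.
- exact: divr_gt0.
- by rewrite /= in_itv/= -ler_norml.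
Unshelve. all: by end_near. Qed.

End OneSidedSlopes.

(** * Strongly monotone residuals *)

Section PiecewiseC2Consequences.
Variable R : realType.
Implicit Types (f : R -> R) (x y : R).

Lemma piecewise_C2_calm f x : piecewise_Ck 2 f ->
  exists L d, [/\ 0 <= L, 0 < d & forall y, `|y - x| < d ->
    `|f y - f x| <= L * `|y - x|].
Proof.
move=> /[dup] -[cf _] /(piecewise_C2_slopes x)[a [b [K [d [K0 S]]]]].
have [d0 _] := S.
exists (`|a| + `|b| + `|K| * d), d; split => //.
  by rewrite !addr_ge0// mulr_ge0// ltW.
by move=> y yd; exact: (slopes_calm cf S).
Qed.

Lemma piecewise_C2_quadratic f x : piecewise_Ck 2 f ->
  exists L d, [/\ 0 <= L, 0 < d & forall y v, `|y - x| < d ->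
    hull2 (left_derivative f y) (right_derivative f y) v ->
    `|f y - f x - v * (y - x)| <= L * `|y - x| ^+ 2].
Proof.
move=> /[dup] -[cf _] /(piecewise_C2_slopes x)[a [b [K [d [K0 S]]]]].
have [d0 _] := S.
exists (2 * `|K|), d; split => //.
by move=> y v yd hv; exact: (slopes_quadratic cf S).
Qed.

Lemma piecewise_C2_smoothing_near_hull f (psi : R -> R -> R) x w :
  piecewise_Ck 2 f -> admissible_smoothing1 f psi -> 0 < w ->
  exists2 e1, 0 < e1 & forall e, 0 < e < e1 ->
    exists2 v, hull2 (left_derivative f x) (right_derivative f x) v &
      `|(psi ^~ e)^`()%classic x - v| <= w.
Proof.
move=> /[dup] -[cf _] /(piecewise_C2_slopes x)[a [b [K [d [K0 S]]]]].
exact: smoothing_slope_near_hull S.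
Qed.

End PiecewiseC2Consequences.

Section Residual.
Variables (R : realType) (n : nat).
Implicit Types (x y v : 'cV[R]_n) (A : 'M[R]_n) (g : 'I_n -> R -> R).

(** Finitely many estimates with their own constants L and radii d hold with common
    ones: the sum of the constants, and a radius below each of the given ones
    without taking a minimum over a possibly empty family. *)
Lemma uniform_over_coords (P : 'I_n -> R -> R -> Prop) :
  (forall i L L' d d', L <= L' -> 0 < d' -> d' <= d -> P i L d -> P i L' d') ->
  (forall i, exists L d, [/\ 0 <= L, 0 < d & P i L d]) ->
  exists L d, [/\ 0 <= L, 0 < d & forall i, P i L d].
Proof.
move=> Pmono /choice[L_ /choice[d_ LdP]].
exists (\sum_i L_ i), (1 + \sum_i (d_ i)^-1)^-1.
have L0 i : 0 <= L_ i by have [] := LdP i.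
have d0 i : 0 < d_ i by have [] := LdP i.
have s0 : 0 <= \sum_i (d_ i)^-1 by apply: sumr_ge0 => i _; rewrite invr_ge0 ltW.
have s1 : 0 < 1 + \sum_i (d_ i)^-1 by rewrite ltr_wpDr.
split; [exact: sumr_ge0 | by rewrite invr_gt0 |] => i.
have [_ _] := LdP i; apply: Pmono; last 2 first.
- by rewrite invr_gt0.
- rewrite -[leRHS]invrK lef_pV2 ?posrE ?invr_gt0// (bigD1 i)//= addrCA lerDl.
  by rewrite addr_ge0// sumr_ge0// => j _; rewrite invr_ge0 ltW.
- by rewrite (bigD1 i)//= lerDl sumr_ge0.
Qed.

Lemma norm2_mulmx_le A : exists2 K : R, 0 <= K &
  forall v, norm2 (A *m v) <= K * norm2 v.
Proof.
pose K := \sum_i \sum_j `|A i j|.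
have K0 : 0 <= K by apply: sumr_ge0 => i _; exact: sumr_ge0.
exists (n%:R * K); first exact: mulr_ge0.
move=> v; rewrite -mulrA; apply: norm2_le_of_coord => [|i].
  by rewrite mulr_ge0// norm2_ge0.
rewrite mxE; apply: le_trans (ler_norm_sum _ _ _) _.
apply: (@le_trans _ _ (\sum_j `|A i j| * norm2 v)).
  by apply: ler_sum => j _; rewrite normrM ler_wpM2l// abs_coord_le_norm2.
rewrite -mulr_suml ler_wpM2r ?norm2_ge0// /K [leRHS](bigD1 i)//= lerDl.
by apply: sumr_ge0 => k _; exact: sumr_ge0.
Qed.

Lemma residualB A g f x y :
  residual A (diag_map g) f x - residual A (diag_map g) f y =
  A *m (x - y) + (diag_map g x - diag_map g y).
Proof. by rewrite /residual mulmxBr; apply/colP => i; rewrite !mxE; ring. Qed.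

Lemma residual_calm A g f x :
  (forall i, exists L d, [/\ 0 <= L, 0 < d & forall t, `|t - x i 0| < d ->
    `|g i t - g i (x i 0)| <= L * `|t - x i 0|]) ->
  exists L d, [/\ 0 < L, 0 < d & forall y, norm2 (y - x) < d ->
    norm2 (residual A (diag_map g) f y - residual A (diag_map g) f x)
      <= L * norm2 (y - x)].
Proof.
move=> /uniform_over_coords[|L [d [L0 d0 gL]]].
  move=> i L L' d d' LL' d'0 d'd h t td.
  by apply: le_trans (h t (lt_le_trans td d'd)) _; rewrite ler_wpM2r.
have [K K0 AK] := norm2_mulmx_le A.
exists (K + n%:R * L + 1), d; split => //.
  by rewrite ltr_wpDl// addr_ge0// mulr_ge0.
move=> y yd; rewrite residualB; apply: le_trans (ler_norm2D _ _) _.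
rewrite !mulrDl mul1r; apply: ler_wpDr; first exact: norm2_ge0.
apply: lerD => //; rewrite -mulrA; apply: norm2_le_of_coord => [|i].
  by rewrite mulr_ge0// norm2_ge0.
have yx : `|y i 0 - x i 0| <= norm2 (y - x).
  by rewrite (le_trans _ (abs_coord_le_norm2 _ i))// !mxE.
rewrite !mxE; apply: le_trans (gL i _ _) _; first exact: le_lt_trans yd.
exact: ler_wpM2l.
Qed.

Lemma residual_strongly_monotone A g f c x y :
  (forall v, c * norm2 v ^+ 2 <= dot v (A *m v)) ->
  (forall i, {homo g i : s t / s <= t}) ->
  c * norm2 (x - y) ^+ 2 <= dot (x - y)
    (residual A (diag_map g) f x - residual A (diag_map g) f y).
Proof.
move=> Ac gmono; rewrite residualB dotDr.
apply: ler_wpDr (Ac _); apply: sumr_ge0 => i _; rewrite !mxE.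
have [xy|/ltW yx] := leP (x i 0) (y i 0).
  by apply: mulr_le0; rewrite subr_le0// gmono.
by apply: mulr_ge0; rewrite subr_ge0// gmono.
Qed.

(** Strong monotonicity and the Cauchy-Schwarz inequality.  This is the source of
    uniqueness, of the boundedness of the iterates, and of the passage from small
    residuals to small distances. *)
Lemma residual_expansive A g f c x y :
  (forall v, c * norm2 v ^+ 2 <= dot v (A *m v)) ->
  (forall i, {homo g i : s t / s <= t}) ->
  c * norm2 (x - y) <=
    norm2 (residual A (diag_map g) f x - residual A (diag_map g) f y).
Proof.
move=> Ac gmono; have h := residual_strongly_monotone f x y Ac gmono.
have [->|xy] := eqVneq (x - y) 0; first by rewrite norm2_0 mulr0 norm2_ge0.
rewrite -(@ler_pM2r _ (norm2 (x - y))) ?norm2_gt0//.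
have := cauchy_schwarz (x - y)
  (residual A (diag_map g) f x - residual A (diag_map g) f y); lra.
Qed.

(** A linear map v |-> (A + diag w) v is itself a residual, with the monotone
    functions t |-> w_i t. *)
Lemma monotone_shift_expansive A (w : 'rV[R]_n) c v :
  (forall v, c * norm2 v ^+ 2 <= dot v (A *m v)) -> (forall i, 0 <= w 0 i) ->
  c * norm2 v <= norm2 ((A + diag_mx w) *m v).
Proof.
move=> Ac w0; have lin u : residual A (diag_map (fun i t => w 0 i * t)) 0 u =
    (A + diag_mx w) *m u.
  rewrite /residual subr0 mulmxDl; congr (_ + _).
  by apply/colP => i; rewrite mul_diag_mx !mxE.
have := @residual_expansive A (fun i t => w 0 i * t) 0 c v 0 Ac.
rewrite !lin mulmx0 !subr0; apply => i s t st.
exact: ler_wpM2l.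
Qed.

Lemma expansive_unitmx (M : 'M[R]_n) c : 0 < c ->
  (forall v, c * norm2 v <= norm2 (M *m v)) -> M \in unitmx.
Proof.
move=> c0 Mc; rewrite -unitmx_tr -row_free_unit -kermx_eq0.
apply/rowV0P => u /sub_kermxP uM; apply: trmx_inj; apply/eqP.
rewrite trmx0 -norm2_eq0 eq_le norm2_ge0 andbT -(pmulr_rle0 _ c0).
by rewrite (le_trans (Mc _))// -[M]trmxK -trmx_mul uM trmx0 norm2_0.
Qed.

Lemma continuous_residual A g f : (forall i, continuous (g i)) ->
  continuous (residual A (diag_map g) f).
Proof.
move=> cg x.
apply: (@continuousB _ _ _ (fun x => A *m x + diag_map g x) (cst f)); last first.
  exact: cst_continuous.
apply: (@continuousD _ _ _ (fun x => A *m x) (diag_map g)).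
  exact: continuous_mulmx.
move: x; apply: continuous_coords => i j.
rewrite (_ : (fun _ => _) = g i \o (fun x : 'cV[R]_n => x i 0)).
  by move=> x; apply: continuous_comp; [exact: coord_continuous|exact: cg].
by apply/funext => x; rewrite mxE.
Qed.

(** The norm of the residual is coercive, so it has a global minimizer x.  If the
    residual h at x were nonzero, then by strong monotonicity the step to x - t h
    would change the squared norm by at most (- 2 c t + L^2 t^2) |h|^2, where L
    bounds the growth of the residual near x; this is negative for small t. *)
Lemma residual_has_zero A g f c : 0 < c ->
  (forall v, c * norm2 v ^+ 2 <= dot v (A *m v)) ->
  (forall i, {homo g i : s t / s <= t}) ->
  (forall i, continuous (g i)) ->
  (forall i s, exists L d, [/\ 0 <= L, 0 < d & forall t, `|t - s| < d ->
    `|g i t - g i s| <= L * `|t - s|]) ->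
  exists x, residual A (diag_map g) f x = 0.
Proof.
move=> c0 Ac gmono cg gcalm; set H := residual A (diag_map g) f.
have Hexp x y : c * norm2 (x - y) <= norm2 (H x - H y).
  exact: residual_expansive.
pose B := 2 * norm2 (H 0) / c.
have B0 : 0 <= B by rewrite !mulr_ge0 ?norm2_ge0// invr_ge0 ltW.
have [||x xB xmin] := @compact_EVT_min _ R (fun x => norm2 (H x)) _ _
  (@compact_norm2_ball R n B).
- by exists 0; rewrite /= norm2_0.
- apply: continuous_subspaceT => x.
  apply: (@continuous_comp _ _ _ H (@norm2 R n)); last exact: continuous_norm2.
  exact: continuous_residual.
have {xB}xmin y : norm2 (H x) <= norm2 (H y).
  have [yB|yB] := leP (norm2 y) B; first by apply: xmin; rewrite inE.
  have Hx0 : norm2 (H x) <= norm2 (H 0) by apply: xmin; rewrite inE/= norm2_0.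
  apply: le_trans Hx0 _; have := Hexp y 0; rewrite subr0.
  have := ler_norm2B (H y) (H 0).
  by move: yB; rewrite /B ltr_pdivrMr//; lra.
exists x; apply/eqP; apply: contraT => Hx; exfalso.
have h0 : 0 < norm2 (H x) by rewrite norm2_gt0.
have [L [d [L0 d0 HL]]] := @residual_calm A g f x (fun i => gcalm i (x i 0)).
(* The first bound keeps x - t h in the ball where L is valid; the second makes
   L^2 t^2 <= c t. *)
pose t := Num.min (d / (2 * norm2 (H x))) (c / L ^+ 2).
have t0 : 0 < t by rewrite lt_min !divr_gt0 ?mulr_gt0 ?exprn_gt0.
pose y := x - t *: H x.
have yx : y - x = (- t) *: H x by rewrite /y addrAC subrr add0r scaleNr.
have nyx : norm2 (y - x) = t * norm2 (H x).
  by rewrite yx norm2Z normrN gtr0_norm.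
have tc : L ^+ 2 * t <= c.
  by rewrite mulrC -ler_pdivlMr ?exprn_gt0// ge_min lexx orbT.
have td : t * (2 * norm2 (H x)) <= d.
  by rewrite -ler_pdivlMr ?mulr_gt0// ge_min lexx.
have hd : norm2 (H y - H x) <= L * (t * norm2 (H x)).
  rewrite -nyx; apply: HL; rewrite nyx; have := mulr_gt0 t0 h0; lra.
have := residual_strongly_monotone f y x Ac gmono; rewrite -/H nyx yx dotZl.
have := xmin y; rewrite -(@ler_pXn2r _ 2) ?nnegrE ?norm2_ge0//.
have {1}-> : H y = H x + (H y - H x) by rewrite addrC subrK.
rewrite (sqr_norm2D (H x)) => h1 h2.
have h3 : norm2 (H y - H x) ^+ 2 <= L ^+ 2 * t * (t * norm2 (H x) ^+ 2).
  rewrite (_ : _ * _ = (L * (t * norm2 (H x))) ^+ 2); last by ring.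
  by rewrite ler_pXn2r ?nnegrE ?norm2_ge0// !mulr_ge0 ?norm2_ge0// ltW.
have h4 : L ^+ 2 * t * (t * norm2 (H x) ^+ 2) <= c * (t * norm2 (H x) ^+ 2).
  by rewrite ler_wpM2r// mulr_ge0 ?sqr_ge0// ltW.
have h5 : 0 < c * (t * norm2 (H x) ^+ 2) by rewrite !mulr_gt0 ?exprn_gt0.
have h6 : dot (H x) (H y - H x) <= - (c * (t * norm2 (H x) ^+ 2)).
  rewrite -(@ler_pM2l _ t)//; move: h2; rewrite expr2; lra.
lra.
Qed.

(** Differentiability is proved for the map as a whole; the entries are then read
    off as directional derivatives of the coordinates along the basis vectors. *)
Lemma Jac_residual A g f x : (forall i, derivable (g i) (x i 0) 1) ->
  Jac (residual A (diag_map g) f) x =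
  A + diag_mx (\row_i (g i)^`()%classic (x i 0)).
Proof.
move=> dg; set G := residual A (diag_map g) f.
have dG : differentiable G x.
  rewrite (_ : G = (fun y => A *m y) +
      \sum_i (fun y : 'cV[R]_n => g i (y i 0) *: delta_mx i 0) - cst f).
    apply: differentiableB; last exact: differentiable_cst.
    apply: differentiableD.
      by apply: linear_differentiable; exact: continuous_mulmx.
    apply: differentiable_sum => i; apply: differentiableZl.
    apply: (@differentiable_comp _ _ _ _ (fun y : 'cV[R]_n => y i 0) (g i)).
      exact: differentiable_coord.
    exact/derivable1_diffP.
  apply/funext => y; rewrite /G /residual.
  rewrite -[RHS]/((A *m y) +
    (\sum_i (fun y : 'cV[R]_n => g i (y i 0) *: delta_mx i 0)) y - f).
  congr (_ + _ - _); apply/colP => i; rewrite fct_sumE summxE (bigD1 i)//=.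
  rewrite !mxE eqxx mulr1 big1 ?addr0// => j ji.
  by rewrite !mxE eq_sym (negbTE ji) mulr0.
apply/matrixP => i j; rewrite [LHS]mxE -deriveE// derive_mx; last first.
  exact: diff_derivable.
have -> : (A + diag_mx (\row_i (g i)^`()%classic (x i 0))) i j =
    A i j + (g i)^`()%classic (x i 0) *+ (i == j).
  by rewrite !mxE.
rewrite [LHS]mxE; apply: cvg_lim => //.
pose q (h : R) := h^-1 *: (g i (h *: 1 + x i 0) - g i (x i 0)).
have qg : q h @[h --> 0^'] --> (g i)^`()%classic (x i 0).
  by rewrite derive1E; exact: dg.
have : (A i j + q h *+ (i == j)) @[h --> 0^'] -->
    A i j + (g i)^`()%classic (x i 0) *+ (i == j).
  by apply: cvgD; [exact: cvg_cst | case: (i == j) => //; exact: cvg_cst].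
apply: cvg_trans; apply: near_eq_cvg; near=> h.
have h0 : h != 0 by near: h; exact: nbhs_dnbhs_neq.
have -> : G (h *: delta_mx j 0 + x) i 0 - G x i 0 =
    h * A i j + (g i (h *+ (i == j) + x i 0) - g i (x i 0)).
  rewrite /G /residual mulmxDr -scalemxAr -colE !mxE.
  by rewrite andbT mulr_natr; ring.
rewrite scalerDr [h^-1 *: (h * _)](mulKf h0); congr (_ + _).
rewrite /q; case: (i == j); first by rewrite scaler1.
by rewrite mulr0n add0r subrr scaler0.
Unshelve. all: by end_near. Qed.

End Residual.

(** * Line search and Newton step *)

Section SufficientDecrease.
Variables (R : realType) (n : nat).
Variables (A : 'M[R]_n) (f : 'cV[R]_n) (g : 'I_n -> R -> R).
Hypothesis dg : forall i t, derivable (g i) t 1.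
Hypothesis cg' : forall i, continuous (g i)^`()%classic.
Implicit Types (x d h : 'cV[R]_n).

Let G := residual A (diag_map g) f.

Lemma residual_uniform_first_order (B w : R) : 0 < w ->
  exists2 r, 0 < r & forall x d t, norm2 x <= B -> norm2 d <= B ->
    0 < t < r -> norm2 (G (x + t *: d) - G x - t *: (Jac G x *m d)) <= w * t.
Proof.
move=> w0; pose M := n%:R * `|B| + 1.
have M0 : 0 < M by rewrite ltr_wpDl// mulr_ge0.
pose P i (_ r : R) := forall s u, `|s| <= B -> `|u| < r ->
  `|g i (s + u) - g i s - (g i)^`()%classic s * u| <= w / M * `|u|.
have [||L [r [_ r0 gr]]] := @uniform_over_coords R n P.
- by move=> i L L' r r' _ _ r'r h s u sB ur'; apply: h => //; exact: lt_le_trans r'r.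
- move=> i; have [|r r0 h] := @uniform_first_order R (g i) B (w / M) (@dg i) (@cg' i).
    exact: divr_gt0.
  by exists 0, r.
exists (r / (`|B| + 1)); first by rewrite divr_gt0// ltr_wpDl.
move=> x d t xB dB /andP[t0 tr].
have B0 : 0 <= B by apply: le_trans xB; exact: norm2_ge0.
have tB : t * B < r.
  move: tr; rewrite ltr_pdivlMr ?ltr_wpDl// ger0_norm// mulrDr mulr1; lra.
apply: (@le_trans _ _ (n%:R * (w / M * (t * B)))).
  apply: norm2_le_of_coord => [|i].
    by rewrite !mulr_ge0 ?invr_ge0 ?(ltW w0) ?(ltW M0) ?(ltW t0).
  rewrite Jac_residual// residualB.
  rewrite (_ : (_ : 'cV[R]_n) i 0 = g i (x i 0 + t * d i 0) - g i (x i 0) -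
      (g i)^`()%classic (x i 0) * (t * d i 0)); last first.
    rewrite [x + _ - x]addrAC subrr add0r mulmxDl -scalemxAr mul_diag_mx.
    by rewrite !mxE; ring.
  have hd : `|t * d i 0| <= t * B.
    rewrite normrM gtr0_norm// ler_wpM2l ?(ltW t0)//.
    exact: le_trans (abs_coord_le_norm2 _ _) dB.
  apply: le_trans (gr i _ _ _ _) _.
  - exact: le_trans (abs_coord_le_norm2 _ _) xB.
  - exact: le_lt_trans tB.
  - by rewrite ler_wpM2l// ltW// divr_gt0.
rewrite (_ : _ * _ = (w * t) * (n%:R * B / M)); last by ring.
rewrite ler_piMr ?mulr_ge0 ?ltW// ltr_pdivrMr// mul1r /M ger0_norm// ltrDl.
exact: ltr01.
Qed.

(** Let J be the Jacobian of G at x and d the direction with h + J d = 0.  Then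
    G (x + t d) = G x - t h + o(t), and the slope of |G|^2 along d is
    - 2 (G x . h) <= - 2 (1 - al) |h|^2 because h - G x is at most al |h| in norm.
    As 2 si < 1 - al there is room for the error, and by uniform differentiability
    the admissible step lengths do not depend on the point. *)
Lemma uniform_sufficient_decrease (B al si b : R) :
  0 < al < 1 -> 0 < si < (1 - al) / 2 -> 0 < b ->
  exists2 r, 0 < r & forall x d h t, norm2 x <= B -> norm2 d <= B ->
    b <= norm2 h -> norm2 (h - G x) <= al * norm2 h ->
    h + Jac G x *m d = 0 -> 0 < t < r ->
    norm2 (G (x + t *: d)) ^+ 2 - norm2 (G x) ^+ 2
      <= - 2 * si * t * norm2 h ^+ 2.
Proof.
move=> /andP[al0 al1] /andP[si0 si1] b0.
(* Relative to t |h|^2, the second-order terms amount to at most t + 7 w, to be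
   absorbed by 1 - al; hence w = (1 - al) / 14 and t < (1 - al) / 2. *)
pose w := (1 - al) / 14.
have w0 : 0 < w by rewrite divr_gt0// subr_gt0.
have [r r0 Gr] := @residual_uniform_first_order B (w * b) (mulr_gt0 w0 b0).
exists (Num.min r ((1 - al) / 2)).
  by rewrite lt_min r0 divr_gt0// subr_gt0.
move=> x d h t xB dB bh hG hd /andP[t0]; rewrite lt_min => /andP[tr ta].
have {}Gr := Gr x d t xB dB (introT andP (conj t0 tr)).
have Jd : Jac G x *m d = - h by apply/eqP; rewrite -addr_eq0 addrC hd.
rewrite Jd scalerN opprK in Gr.
set e := _ + t *: h in Gr.
have -> : G (x + t *: d) = (G x - t *: h) + e.
  by rewrite /e; apply/colP => i; rewrite !mxE; ring.
set k := norm2 h in bh hG *.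
have k0 : 0 < k by exact: lt_le_trans bh.
have wk : norm2 e <= w * t * k.
  apply: le_trans Gr _; rewrite mulrAC ler_wpM2l//.
  by rewrite mulr_ge0// ltW.
have e0 := norm2_ge0 e.
have Gh : (1 - al) * k ^+ 2 <= dot (G x) h.
  have := dot_ge_norm2 (G x - h) h; rewrite norm2_distC dotDl dotNl -sqr_norm2 -/k.
  have : norm2 (h - G x) * k <= al * k * k by rewrite ler_wpM2r// ltW.
  by rewrite expr2; lra.
have nG : norm2 (G x) <= 2 * k.
  by have := norm2_le_distD (G x) h; rewrite norm2_distC -/k; nra.
have n2 : norm2 (G x - t *: h) <= 3 * k.
  have := ler_norm2B (G x) (t *: h); rewrite norm2Z gtr0_norm// -/k; nra.
have n1 : norm2 (G x - t *: h) ^+ 2 <=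
    norm2 (G x) ^+ 2 - 2 * t * ((1 - al) * k ^+ 2) + t * t * k ^+ 2.
  rewrite sqr_norm2D dotNr dotZr norm2N norm2Z gtr0_norm// -/k exprMn expr2.
  have := ler_wpM2l (ltW t0) Gh; lra.
rewrite sqr_norm2D.
have cs := cauchy_schwarz (G x - t *: h) e.
have d1 : norm2 (G x - t *: h) * norm2 e <= 3 * k * (w * t * k).
  by apply: ler_pM => //; exact: norm2_ge0.
have d2 : norm2 e ^+ 2 <= (w * t * k) * (w * t * k).
  by rewrite expr2; exact: ler_pM.
have d3 : (w * t * k) * (w * t * k) <= w * t * k * k.
  have wtk0 : 0 <= w * t * k by apply: mulr_ge0; [apply: mulr_ge0|]; exact: ltW.
  have wt1 : w * t <= 1.
    by apply: mulr_ile1; rewrite ?(ltW w0) ?(ltW t0)// /w; lra.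
  by apply: ler_wpM2l => //; apply: ler_piMl => //; exact: ltW k0.
have tk0 : 0 <= t * k ^+ 2 by rewrite mulr_ge0 ?sqr_ge0// ltW.
have d4 : (t * k ^+ 2) * (t + 7 * w) <= (t * k ^+ 2) * (1 - al).
  by apply: ler_wpM2l => //; rewrite /w; lra.
have d5 : (t * k ^+ 2) * (2 * si) <= (t * k ^+ 2) * (1 - al).
  by apply: ler_wpM2l => //; lra.
lra.
Qed.

End SufficientDecrease.

Section Smoothing.
Variables (R : realType) (n : nat) (A : 'M[R]_n) (f : 'cV[R]_n).
Variables (phi : 'I_n -> R -> R) (N : 'M[R]_n -> R).
Hypothesis normN : is_mxnorm N.
Implicit Types (X V : 'M[R]_n) (S : set 'M[R]_n).

Lemma mxdist_le X V S : S V -> mxdist N X S <= N (X - V).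
Proof.
move=> SV; apply: ge_inf; last by exists V.
by exists 0 => _ [W _ <-]; exact: mxnorm_ge0.
Qed.

(** Nonemptiness matters, since the infimum of the empty set is 0 by convention. *)
Lemma mxdist_lt_witness X S e : S !=set0 -> mxdist N X S < e ->
  exists2 V, S V & N (X - V) < e.
Proof.
move=> [W SW] /inf_lt[|_ [V SV <-] NV]; last by exists V.
by exists (N (X - W)), W.
Qed.

Lemma dC_residual_nonempty x : dC_residual A phi x !=set0.
Proof.
pose d : 'rV[R]_n := \row_i left_derivative (phi i) (x i 0).
exists (A + diag_mx d), (diag_mx d) => //; exists d => //= i.
exists 0; first by rewrite /= in_itv/= lexx ler01.
by rewrite line_path0 mxE.
Qed.

Lemma smoothing_mxdist_small (psi : 'I_n -> R -> R -> R) x b w :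
  (forall i, piecewise_Ck 2 (phi i)) ->
  (forall i, admissible_smoothing1 (phi i) (psi i)) -> 0 < b -> 0 < w ->
  exists2 e, 0 < e <= b & mxdist N
    (Jac (residual A (diag_map (fun i t => psi i t e)) f) x)
    (dC_residual A phi x) <= w.
Proof.
move=> pC2 sm b0 w0; have [K K0 NK] := mxnorm_diag_le normN.
pose P i (_ r : R) := forall e, 0 < e < r ->
  exists2 v, hull2 (left_derivative (phi i) (x i 0))
                   (right_derivative (phi i) (x i 0)) v &
      `|(psi i ^~ e)^`()%classic (x i 0) - v| <= w / K.
have [||L [r [_ r0 Pr]]] := @uniform_over_coords R n P.
- move=> i L L' r r' _ _ r'r h e /andP[e0 er]; apply: h.
  by rewrite e0 (lt_le_trans er).
- move=> i.
  have [|r r0 h] := piecewise_C2_smoothing_near_hull (x i 0) (w := w / K) (pC2 i) (sm i).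
    exact: divr_gt0.
  by exists 0, r.
pose e := Num.min b (r / 2).
have e0 : 0 < e by rewrite lt_min b0 divr_gt0.
have er : e < r by rewrite gt_min ltr_pdivrMr// ltr_pMr// ltr1n orbT.
exists e; first by rewrite e0 ge_min lexx.
have /choice[v vP] : forall i, exists v,
    hull2 (left_derivative (phi i) (x i 0)) (right_derivative (phi i) (x i 0)) v
    /\ `|(psi i ^~ e)^`()%classic (x i 0) - v| <= w / K.
  move=> i; have [|v hv1 hv2] := Pr i e; first by rewrite e0.
  by exists v.
rewrite Jac_residual; last first.
  by move=> i; have [/(_ e e0)[h _] _ _ _] := sm i; exact: h.
have SV : dC_residual A phi x (A + diag_mx (\row_i v i)).
  exists (diag_mx (\row_i v i)) => //; exists (\row_i v i) => //= i.
  by rewrite mxE; have [] := vP i.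
apply: le_trans (mxdist_le _ SV) _.
rewrite opprD addrACA subrr add0r -raddfB/=.
rewrite -[leRHS](divfK (lt0r_neq0 K0)) mulrC; apply: NK.
  by rewrite divr_ge0 ?ltW.
by move=> i; rewrite !mxE; have [] := vP i.
Qed.

(** Put J = A + diag w and let A + diag v be an element of the generalized Jacobian
    close to J.  As J d = - H x, the vector J (x + d - xs) has the coordinates
    (w_i - v_i) (x_i - xs_i)
      - (phi_i (x_i) - phi_i (xs_i) - v_i (x_i - xs_i)).
    The first term is quadratic because |w_i - v_i| = O(|H x|) = O(|x - xs|), the
    second by the estimate for piecewise C2 functions, and J is expansive. *)
Lemma newton_step_quadratic c ga xs :
  (forall i, piecewise_Ck 2 (phi i)) ->
  0 < c -> (forall v, c * norm2 v ^+ 2 <= dot v (A *m v)) -> 0 < ga ->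
  residual A (diag_map phi) f xs = 0 ->
  exists C r, [/\ 0 < C, 0 < r & forall x d (w : 'rV[R]_n),
    norm2 (x - xs) < r ->
    residual A (diag_map phi) f x != 0 ->
    (forall i, 0 <= w 0 i) ->
    mxdist N (A + diag_mx w) (dC_residual A phi x)
      <= ga * norm2 (residual A (diag_map phi) f x) ->
    residual A (diag_map phi) f x + (A + diag_mx w) *m d = 0 ->
    norm2 (x + d - xs) <= C * norm2 (x - xs) ^+ 2].
Proof.
move=> pC2 c0 Ac ga0; set H := residual _ _ _ => Hxs.
have [k k0 Nk] := mxnorm_diag_ge normN.
have [L [r1 [L0 r10 HL]]] := @residual_calm R n A phi f xs
  (fun i => piecewise_C2_calm (xs i 0) (pC2 i)).
pose P i (L r : R) := forall t v, `|t - xs i 0| < r ->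
    hull2 (left_derivative (phi i) t) (right_derivative (phi i) t) v ->
    `|phi i t - phi i (xs i 0) - v * (t - xs i 0)| <= L * `|t - xs i 0| ^+ 2.
have [||Q [r2 [Q0 r20 PQ]]] := @uniform_over_coords R n P.
- move=> i l l' r r' ll' _ r'r h t v tr hv.
  apply: le_trans (h t v (lt_le_trans tr r'r) hv) _.
  by rewrite ler_wpM2r// sqr_ge0.
- by move=> i; exact: piecewise_C2_quadratic.
pose E := 2 * ga * L / k + Q.
have E0 : 0 <= E by rewrite addr_ge0// !mulr_ge0 ?invr_ge0// ltW.
exists (n%:R * E / c + 1), (Num.min r1 r2); split.
- by rewrite ltr_wpDl//; apply: divr_ge0; [exact: mulr_ge0|exact: ltW].
- by rewrite lt_min r10.
move=> x d w; rewrite lt_min => /andP[xr1 xr2] Hx w0 dist newt.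
have {}HL : norm2 (H x) <= L * norm2 (x - xs).
  by have := HL x xr1; rewrite -/H Hxs subr0.
have Hx0 : 0 < norm2 (H x) by rewrite norm2_gt0.
have [||V [_ [v hv <-] <-] NV] := @mxdist_lt_witness (A + diag_mx w)
    (dC_residual A phi x) (2 * ga * norm2 (H x)).
- exact: dC_residual_nonempty.
- by apply: le_lt_trans dist _; have := mulr_gt0 ga0 Hx0; rewrite -/H; lra.
set D := norm2 (x - xs) in xr1 xr2 HL *.
have wv i : `|w 0 i - v 0 i| <= 2 * ga * L / k * D.
  have := Nk (w - v) i; rewrite !mxE; move: NV.
  rewrite opprD addrACA subrr add0r -raddfB/= => h1 h2.
  rewrite mulrAC ler_pdivlMr// mulrC; apply: le_trans h2 _.
  by apply: le_trans (ltW h1) _; rewrite -!mulrA !ler_pM2l.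
have D0 : 0 <= D by exact: norm2_ge0.
have key : norm2 ((A + diag_mx w) *m (x + d - xs)) <= n%:R * (E * D ^+ 2).
  apply: norm2_le_of_coord => [|i]; first by rewrite mulr_ge0// sqr_ge0.
  have -> : ((A + diag_mx w) *m (x + d - xs)) =
      diag_mx w *m (x - xs) - (diag_map phi x - diag_map phi xs).
    rewrite addrAC mulmxDr.
    have -> : (A + diag_mx w) *m d = - (H x - H xs).
      by apply/eqP; rewrite -addr_eq0 Hxs subr0 addrC newt.
    rewrite residualB mulmxDl opprD addrACA.
    by rewrite [X in X + _ = _]addrC addrA addNr add0r.
  rewrite mul_diag_mx !mxE.
  have xi : `|x i 0 - xs i 0| <= D.
    by rewrite (le_trans _ (abs_coord_le_norm2 _ i))// !mxE.
  have q : `|phi i (x i 0) - phi i (xs i 0) - v 0 i * (x i 0 - xs i 0)| <= Q * D ^+ 2.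
    apply: le_trans (PQ i _ _ (le_lt_trans xi xr2) (hv i)) _.
    by rewrite ler_wpM2l// lerXn2r ?nnegrE.
  rewrite (_ : _ - _ = (w 0 i - v 0 i) * (x i 0 - xs i 0) -
    (phi i (x i 0) - phi i (xs i 0) - v 0 i * (x i 0 - xs i 0))); last by ring.
  apply: le_trans (ler_normB _ _) _; rewrite /E [leRHS]mulrDl; apply: lerD => //.
  by rewrite normrM expr2 mulrA; apply: ler_pM.
have := le_trans (monotone_shift_expansive (x + d - xs) Ac w0) key.
rewrite mulrC -ler_pdivlMr// => h; apply: le_trans h _.
rewrite [leRHS]mulrDl mul1r ler_wpDr ?sqr_ge0//.
by rewrite (_ : _ / c = n%:R * E / c * D ^+ 2)//; ring.
Qed.

End Smoothing.

(** * Runs of the algorithm *)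

Section Run.
Variables (R : realType) (n : nat) (A : 'M[R]_n) (f : 'cV[R]_n).
Variables (phi : 'I_n -> R -> R) (Ft : 'cV[R]_n -> R -> 'cV[R]_n).
Variables (psi : 'I_n -> R -> R -> R) (N : 'M[R]_n -> R) (p : params R).
Variables (c : R) (xs : 'cV[R]_n).

Let H := residual A (diag_map phi) f.
Let Ht := fun x e => residual A (Ft ^~ e) f x.
Let dCH := dC_residual A phi.

Hypothesis c_gt0 : 0 < c.
Hypothesis A_coercive : forall v, c * norm2 v ^+ 2 <= dot v (A *m v).
Hypothesis phi_mono : forall i, {homo phi i : x y / x <= y}.
Hypothesis phi_pwC2 : forall i, piecewise_Ck 2 (phi i).
Hypothesis FtE : forall x (e : R), 0 < e ->
  Ft x e = diag_map (fun i t => psi i t e) x.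
Hypothesis psi_smoothing : forall i, admissible_smoothing1 (phi i) (psi i).
Hypothesis normN : is_mxnorm N.
Hypothesis prm : admissible_params H Ht p.
Hypothesis Hxs : H xs = 0.

Implicit Types (s : state R n) (x y d : 'cV[R]_n).

Let al := alpha p.
Let rho01 : 0 < rho p < 1. Proof. by case: prm => -[]. Qed.
Let al01 : 0 < al < 1. Proof. by case: prm => -[]. Qed.
Let eta01 : 0 < eta p < 1. Proof. by case: prm => -[]. Qed.
Let gamma_gt0 : 0 < gamma p. Proof. by case: prm. Qed.
Let sigma01 : 0 < sigma p < (1 - al) / 2. Proof. by case: prm. Qed.
Let mu_gt0 : 0 < mu p. Proof. by case: prm => _ _ _ []. Qed.
Let Ht_near x e : 0 < e -> norm2 (Ht x e - H x) <= mu p * e.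
Proof. by case: prm => _ _ _ [_]; exact. Qed.

Lemma HtE e : 0 < e ->
  Ht ^~ e = residual A (diag_map (fun i t => psi i t e)) f.
Proof. by move=> e0; apply/funext => x; rewrite /Ht /residual FtE. Qed.

(** The diagonal part is nonnegative because smoothing preserves monotonicity; this
    makes every Newton system solvable with a bound that does not depend on e. *)
Lemma Jac_Ht e x : 0 < e -> exists2 w : 'rV[R]_n,
  Jac (Ht ^~ e) x = A + diag_mx w & forall i, 0 <= w 0 i.
Proof.
move=> e0; have dpsi i t : derivable (psi i ^~ e) t 1.
  by have [/(_ e e0)[h _] _ _ _] := @psi_smoothing i; exact: h.
exists (\row_i (psi i ^~ e)^`()%classic (x i 0)); first by rewrite HtE// Jac_residual.
move=> i; rewrite mxE; apply: nondecreasing_derive1_ge0 => //.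
by have [_ _ /(_ e e0) h _] := @psi_smoothing i.
Qed.

Lemma Jac_Ht_expansive e x v : 0 < e ->
  c * norm2 v <= norm2 (Jac (Ht ^~ e) x *m v).
Proof.
by move=> e0; have [w -> w0] := Jac_Ht x e0; exact: monotone_shift_expansive.
Qed.

Lemma H_expansive x y : c * norm2 (x - y) <= norm2 (H x - H y).
Proof. exact: residual_expansive. Qed.

(** What the update rule for eps and beta maintains at every iterate that is not a
    solution.  The gap condition makes the Newton direction a descent direction;
    the bound on the smoothed residual survives the steps between two updates,
    during which eps and beta are constant. *)
Record invariant s : Prop := Invariant {
  eps_gt0 : 0 < eps s;
  eps_le_beta : mu p * eps s <= al / 2 * beta s;
  gap_le : norm2 (H (iterate s) - Ht (iterate s) (eps s))
             <= al * norm2 (H (iterate s));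
  smoothed_le : norm2 (Ht (iterate s) (eps s)) <= (1 + al / 2) * beta s }.

Lemma beta_ge0 s : invariant s -> 0 <= beta s.
Proof.
have /andP[al0 _] := al01.
move=> [_ _ _ sm]; have := le_trans (norm2_ge0 _) sm.
by rewrite pmulr_rge0 ?addr_gt0 ?divr_gt0.
Qed.

Lemma invariant_restart s : 0 < eps s -> beta s = norm2 (H (iterate s)) ->
  eps s <= al / (2 * mu p) * beta s -> invariant s.
Proof.
move=> e0 bE eb; have /andP[al0 al1] := al01.
have mb : mu p * eps s <= al / 2 * beta s.
  have -> : al / 2 * beta s = mu p * (al / (2 * mu p) * beta s).
    by field; rewrite gt_eqF.
  by rewrite ler_pM2l.
have b0 : 0 <= beta s by rewrite bE norm2_ge0.
have gap := Ht_near (iterate s) e0.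
split => //; first by rewrite norm2_distC -bE; nra.
by have := norm2_le_distD (Ht (iterate s) (eps s)) (H (iterate s)); rewrite -bE; lra.
Qed.

Lemma decrease_norm2 s d m :
  sufficient_decrease H Ht p s d m =
  (norm2 (Ht (next_iterate p s d m) (eps s)) ^+ 2
   - norm2 (Ht (iterate s) (eps s)) ^+ 2 <=
   - 2 * sigma p * rho p ^+ m * norm2 (H (iterate s)) ^+ 2).
Proof.
rewrite /sufficient_decrease /theta_eps /theta -mulrBl.
by rewrite [in LHS]mulrA ler_pM2r ?invr_gt0.
Qed.

Lemma smoothed_residual_decreases s s' : step H Ht dCH N p s s' ->
  norm2 (Ht (iterate s') (eps s)) <= norm2 (Ht (iterate s) (eps s)).
Proof.
move=> [Hs [d [m [_ [+ _] -> _]]]]; rewrite decrease_norm2// => h.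
rewrite -(@ler_pXn2r _ 2) ?nnegrE ?norm2_ge0//.
rewrite -subr_le0; apply: le_trans h _; rewrite mulNr !mulNr oppr_le0.
have /andP[s0 _] := sigma01; have /andP[r0 _] := rho01.
by rewrite !mulr_ge0 ?norm2_ge0 ?exprn_ge0 ?(ltW s0) ?(ltW r0).
Qed.

(** If the test fails, its second alternative fails as well, and this is the gap
    condition for the old eps.  If it succeeds, eps is small relative to the new
    residual.  In that case beta shrinks: either by the factor eta, or because the
    new residual is at most mu eps / al <= beta / 2. *)
Lemma invariant_step s s' : invariant s -> step H Ht dCH N p s s' ->
  H (iterate s') != 0 ->
  invariant s' /\
  if update_test H Ht p s (iterate s') then
    beta s' <= Num.max (eta p) (1 / 2) * beta s /\
    beta s' = norm2 (H (iterate s')) /\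
    mxdist N (Jac (Ht ^~ (eps s')) (iterate s')) (dCH (iterate s'))
      <= gamma p * norm2 (H (iterate s'))
  else beta s' = beta s /\ eps s' = eps s.
Proof.
move=> inv st Hs'; have [e0 eb gap sm] := inv; have le := smoothed_residual_decreases st.
have /andP[al0 al1] := al01.
case: st => _ [d [m [_ _ _ /(_ Hs')]]]; rewrite /update.
case: ifP => [test|/negbT test] [bE]; last first.
  move=> eE; split => //; split; rewrite ?bE ?eE//; last exact: le_trans sm.
  move: test; rewrite /update_test -ltNge gt_max => /andP[_].
  by rewrite mulrC ltr_pdivrMr// mulrC => /ltW.
move=> [/andP[e'0]]; rewrite le_min => /andP[e'b _] dist.
split; first by apply: invariant_restart => //; rewrite bE.
split => //; rewrite bE; apply: le_trans test _.
have b0 := beta_ge0 inv.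
rewrite maxr_pMl//; apply: le_max2 => //; rewrite mulrC ler_pdivrMr//.
by rewrite norm2_distC (le_trans (Ht_near _ e0))// (le_trans eb)// -/al; lra.
Qed.

Lemma reachable_invariant x0 s : reachable H Ht dCH N p x0 s ->
  H (iterate s) != 0 -> invariant s.
Proof.
elim=> [|{}s s' _ IH st] Hs; last first.
  by have [Hs0 _] := st; have [] := invariant_step (IH Hs0) st Hs.
have /andP[al0 al1] := al01.
apply: invariant_restart => //=.
by rewrite mulr_gt0 ?norm2_gt0// divr_gt0// mulr_gt0.
Qed.

Lemma newton_direction_unique s : invariant s ->
  exists! d, newton_direction H Ht s d.
Proof.
move=> [e0 _ _ _]; rewrite /newton_direction.
set J := Jac _ _; have uJ : J \in unitmx.
  by apply: (expansive_unitmx c_gt0) => v; exact: Jac_Ht_expansive.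
exists (- (invmx J *m H (iterate s))); split.
  by rewrite mulmxN mulmxA mulmxV// mul1mx subrr.
move=> d /eqP; rewrite addr_eq0 => /eqP ->.
by rewrite mulmxN opprK mulmxA mulVmx// mul1mx.
Qed.

Lemma newton_direction_le s d : invariant s -> newton_direction H Ht s d ->
  c * norm2 d <= norm2 (H (iterate s)).
Proof.
move=> [e0 _ _ _] /eqP; rewrite addr_eq0 => /eqP ->.
by rewrite norm2N Jac_Ht_expansive.
Qed.

(** The threshold r depends on eps and on bounds for the iterate, the direction and
    the residual, but not on the state; this uniformity is what rules out step
    lengths tending to 0. *)
Lemma decrease_for_small_steps e B b : 0 < e -> 0 < b ->
  exists2 r, 0 < r & forall s d m, invariant s -> eps s = e ->
    newton_direction H Ht s d -> norm2 (iterate s) <= B -> norm2 d <= B ->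
    b <= norm2 (H (iterate s)) -> rho p ^+ m < r ->
    sufficient_decrease H Ht p s d m.
Proof.
move=> e0 b0.
have dpsi i t : derivable (psi i ^~ e) t 1.
  by have [/(_ e e0)[h _] _ _ _] := @psi_smoothing i; exact: h.
have cpsi i : continuous (psi i ^~ e)^`()%classic.
  by have [/(_ e e0)[_ h] _ _ _] := @psi_smoothing i.
have [r r0 h] := @uniform_sufficient_decrease R n A f _ dpsi cpsi B al (sigma p)
  b al01 sigma01 b0.
exists r => // s d m [_ _ gap _] es nd xB dB bH rm.
rewrite decrease_norm2.
have E y : Ht y e = residual A (diag_map (fun i t => psi i t e)) f y.
  by rewrite -HtE.
move: gap nd; rewrite /newton_direction es HtE// !E => gap nd.
apply: h => //; rewrite rm andbT exprn_gt0//.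
by case/andP: rho01.
Qed.

Lemma rho_expn_small r : 0 < r -> exists m, rho p ^+ m < r.
Proof.
move=> r0; have /andP[rho0 rho1] := rho01.
have : (fun m => rho p ^+ m) @ \oo --> (0 : R).
  by apply: cvg_expr; rewrite ger0_norm ?ltW.
move=> /cvgrPdist_lt /(_ r r0)[m _ h]; exists m.
by have := h m (leqnn m); rewrite /= sub0r normrN ger0_norm// exprn_ge0// ltW.
Qed.

Lemma step_exponent_exists s d : invariant s -> H (iterate s) != 0 ->
  newton_direction H Ht s d -> exists m, is_step_exponent H Ht p s d m.
Proof.
move=> inv Hs nd; have [e0 _ _ _] := inv.
have b0 : 0 < norm2 (H (iterate s)) by rewrite norm2_gt0.
have [r r0 h] := @decrease_for_small_steps (eps s)
  (norm2 (iterate s) + norm2 d) _ e0 b0.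
have [m mr] := rho_expn_small r0.
have ex : exists m, sufficient_decrease H Ht p s d m.
  by exists m; apply: h; rewrite ?lerDl ?lerDr ?norm2_ge0.
exists (ex_minn ex); case: ex_minnP => k hk kmin; split => // j jk.
by apply: contraL jk => /kmin; rewrite -leqNgt.
Qed.

Lemma algorithm_well_defined x0 : well_defined H Ht dCH N p x0.
Proof.
move=> s rs Hs; have inv := reachable_invariant rs Hs.
split; first exact: newton_direction_unique.
move=> d nd; split; first exact: step_exponent_exists.
move=> m _; set y := next_iterate _ _ _ _ => Hy _.
have y0 : 0 < norm2 (H y) by rewrite norm2_gt0.
have /andP[al0 _] := al01.
have [||e /andP[e0 eb] dist] := @smoothing_mxdist_small R n A f phi N normN psi y
  (Num.min (alpha p / (2 * mu p) * norm2 (H y)) (eps s / 2))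
  (gamma p * norm2 (H y)) phi_pwC2 psi_smoothing.
- rewrite lt_min mulr_gt0// ?divr_gt0// ?mulr_gt0//.
  by case: inv.
- exact: mulr_gt0.
by exists e; split; [rewrite e0 | rewrite HtE].
Qed.

Lemma residual_le_beta s : invariant s -> norm2 (H (iterate s)) <= 2 * beta s.
Proof.
move=> inv; have [e0 eb gap sm] := inv; have /andP[al0 al1] := al01.
have := norm2_le_distD (H (iterate s)) (Ht (iterate s) (eps s)).
rewrite norm2_distC; have := Ht_near (iterate s) e0.
have b0 := beta_ge0 inv.
nra.
Qed.

Section InfiniteRun.
Variables (x0 : 'cV[R]_n) (s_ : nat -> state R n).
Hypothesis run : infinite_run H Ht dCH N p x0 s_.

Let x_ k := iterate (s_ k).
Let test k := update_test H Ht p (s_ k) (x_ k.+1).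

Let st k : step H Ht dCH N p (s_ k) (s_ k.+1). Proof. by case: run. Qed.

Let Hx k : H (x_ k) != 0. Proof. by have [] := st k. Qed.

Let inv k : invariant (s_ k).
Proof.
apply: (@reachable_invariant x0); last exact: Hx.
elim: k => [|k IH].
  by case: run => -> _; exact: reachable_init.
exact: reachable_step (st k).
Qed.

(** Without updates from k on, eps and beta are constant and the residual stays
    above eta beta, while the iterates and directions stay bounded.  The step
    lengths are then bounded below, so each step lowers the squared smoothed
    residual by at least a fixed q > 0, which cannot go on forever. *)
Lemma updates_recur k : exists2 j, (k <= j)%N & test j.
Proof.
apply: contrapT => notest.
have {}notest j : (k <= j)%N -> ~~ test j.
  by move=> kj; apply/negP => tj; apply: notest; exists j.
pose e := eps (s_ k); pose b := beta (s_ k).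
have frozen i : beta (s_ (k + i)) = b /\ eps (s_ (k + i)) = e.
  elim: i => [|i [IHb IHe]]; first by rewrite addn0.
  have [_] := invariant_step (inv (k + i)) (st (k + i)) (@Hx (k + i).+1).
  rewrite addnS; have /negbTE := notest (k + i)%N (leq_addr _ _).
  by rewrite /test /x_ => -> [-> ->].
have e0 : 0 < e by have [] := inv k.
have /andP[al0 al1] := al01; have /andP[eta0 eta1] := eta01.
have /andP[rho0 rho1] := rho01; have /andP[sig0 _] := sigma01.
have H2b i : norm2 (H (x_ (k + i))) <= 2 * b.
  by have := residual_le_beta (inv (k + i)); rewrite (frozen i).1.
have b0 : 0 < b.
  have := H2b 0%N; have : 0 < norm2 (H (x_ (k + 0))) by rewrite norm2_gt0.
  lra.
have Hlow i : eta p * b <= norm2 (H (x_ (k + i).+1)).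
  have := notest (k + i)%N (leq_addr _ _).
  rewrite /test /update_test -ltNge gt_max (frozen i).1 => /andP[h _].
  exact: ltW.
pose B := norm2 xs + 2 * b / c.
have bc0 : 0 <= 2 * b / c by rewrite !mulr_ge0 ?invr_ge0// ltW.
have xB i : norm2 (x_ (k + i)) <= B.
  have := norm2_le_distD (x_ (k + i)) xs.
  have : norm2 (x_ (k + i) - xs) <= 2 * b / c.
    rewrite ler_pdivlMr// mulrC (le_trans (H_expansive _ _))//.
    by rewrite Hxs subr0.
  rewrite /B; lra.
have [r r0 hr] := @decrease_for_small_steps e B (eta p * b) e0 (mulr_gt0 eta0 b0).
(* Unless the full step is taken, rho^(m-1) was rejected and is thus at least r. *)
pose tau := Num.min 1 (rho p * r).
have tau0 : 0 < tau by rewrite lt_min ltr01 mulr_gt0.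
pose q := 2 * sigma p * tau * (eta p * b) ^+ 2.
have q0 : 0 < q by rewrite !mulr_gt0 ?exprn_gt0 ?mulr_gt0.
pose T i := norm2 (Ht (x_ (k + i).+1) e) ^+ 2.
have Tdec i : T i.+1 <= T i - q.
  rewrite /T -(addnS k i); have [_ [d [m [nd [dm mmin] xE _]]]] := st (k + i.+1).
  have [_ ee] := frozen i.+1.
  move: (dm); rewrite decrease_norm2 -xE ee -/(x_ _) -/(x_ _).
  have Hi := Hlow i; rewrite -addnS in Hi.
  have taum : tau <= rho p ^+ m.
    case: m dm mmin {xE} => [|m] dm mmin; first by rewrite expr0 ge_min lexx.
    rewrite exprS ge_min; apply/orP; right; rewrite ler_pM2l// leNgt.
    apply/negP => rm; have /negP := mmin m (ltnSn m); apply.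
    apply: (hr _ _ _ (inv _) ee nd (xB _)) => //.
    rewrite -(@ler_pM2l _ c)// (le_trans (newton_direction_le (inv _) nd))//.
    apply: le_trans (H2b _) _; rewrite /B mulrDr [c * (_ / c)]mulrC.
    by rewrite divfK ?gt_eqF// lerDr mulr_ge0 ?norm2_ge0// ltW.
  have : q <= 2 * sigma p * rho p ^+ m * norm2 (H (x_ (k + i.+1))) ^+ 2.
    apply: ler_pM.
    - by rewrite !mulr_ge0// ltW.
    - exact: sqr_ge0.
    - by rewrite ler_pM2l// mulr_gt0.
    - by rewrite ler_pXn2r ?nnegrE ?norm2_ge0// ltW// mulr_gt0.
  rewrite mulNr !mulNr; lra.
have Tlow i : T i <= T 0%N - q *+ i.
  elim: i => [|i IH]; first by rewrite mulr0n subr0.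
  by rewrite mulrSr; have := Tdec i; lra.
have [i hi] : exists i : nat, T 0%N / q < i%:R.
  exists (Num.truncn (T 0%N / q)).+1.
  by apply: truncnS_gt.
move: hi; rewrite ltr_pdivrMr// mulr_natl => hi.
have := Tlow i; have : 0 <= T i by exact: sqr_ge0.
lra.
Qed.

Lemma beta_nonincreasing k j : (k <= j)%N -> beta (s_ j) <= beta (s_ k).
Proof.
move=> /subnK <-; elim: (j - k)%N => [|i IH]; first by rewrite add0n.
rewrite addSn; apply: le_trans IH.
have [_] := invariant_step (inv (i + k)) (st (i + k)) (@Hx (i + k).+1).
case: ifP => _ [+ _]; last by move=> ->.
move=> h; apply: le_trans h _.
have b0 := beta_ge0 (inv (i + k)).
rewrite ler_piMl// ge_max; have /andP[_ /ltW ->] := eta01.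
lra.
Qed.

Lemma beta_vanishes e : 0 < e ->
  exists k, forall j, (k <= j)%N -> beta (s_ j) <= e.
Proof.
move=> e0; pose q := Num.max (eta p) (1 / 2).
have /andP[eta0 eta1] := eta01.
have q0 : 0 < q by rewrite lt_max eta0.
have q1 : q < 1 by rewrite gt_max eta1 ltr_pdivrMr//; lra.
have geo m : exists k, beta (s_ k) <= q ^+ m * beta (s_ 0%N).
  elim: m => [|m [k IH]]; first by exists 0%N; rewrite mul1r.
  have [j kj tj] := updates_recur k; exists j.+1.
  have [_] := invariant_step (inv j) (st j) (@Hx j.+1).
  rewrite -/(x_ _) -/(test j) tj => -[h _]; apply: le_trans h _.
  rewrite exprS -mulrA ler_pM2l//.
  exact: le_trans (beta_nonincreasing kj) IH.
have : (fun m => q ^+ m * beta (s_ 0%N)) @ \oo --> 0 * beta (s_ 0%N).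
  by apply: cvgMl; apply: cvg_expr; rewrite ger0_norm// ltW.
rewrite mul0r => /cvgr0Pnorm_le /(_ e e0)[m _ hm].
have [k hk] := geo m; exists k => j kj.
apply: le_trans (beta_nonincreasing kj) _; apply: le_trans hk _.
exact: le_trans (ler_norm _) (hm m (leqnn m)).
Qed.

Lemma dist_vanishes e : 0 < e ->
  exists k, forall j, (k <= j)%N -> norm2 (x_ j - xs) < e.
Proof.
move=> e0; have [|k hk] := @beta_vanishes (c * e / 4).
  by rewrite divr_gt0// mulr_gt0.
exists k => j /hk bj; rewrite -(@ltr_pM2l _ c)//.
apply: le_lt_trans (H_expansive _ _) _; rewrite Hxs subr0.
apply: le_lt_trans (residual_le_beta (inv j)) _.
have := mulr_gt0 c_gt0 e0; lra.
Qed.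

Lemma run_converges : x_ @ \oo --> xs.
Proof.
apply: cV_cvgP; apply/cvgr0Pnorm_le => e e0.
have [k hk] := dist_vanishes e0; exists k => // j /= kj.
by rewrite ger0_norm ?norm2_ge0// ltW// hk.
Qed.

(** Right after an update the smoothed Jacobian is within gamma |H x| of the
    generalized Jacobian, so the full Newton step is quadratic.  Near xs it brings
    the residual below kap |H x|, which is enough both for the line search to accept
    it and for the next update test to succeed.  One update close to xs therefore
    makes every later iteration a full Newton step of the same kind. *)
Lemma run_quadratic : exists C : R, 0 < C /\
  \forall k \near \oo, norm2 (x_ k.+1 - xs) <= C * norm2 (x_ k - xs) ^+ 2.
Proof.
have /andP[al0 al1] := al01; have /andP[eta0 eta1] := eta01.
have /andP[sig0 sig1] := sigma01.
have [C [r [C0 r0 quad]]] := @newton_step_quadratic R n A f phi N normN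
  c (gamma p) xs phi_pwC2 c_gt0 A_coercive gamma_gt0 Hxs.
have [L [r1 [L0 r10 calm]]] := @residual_calm R n A phi f xs
  (fun i => piecewise_C2_calm (xs i 0) (phi_pwC2 i)).
(* kap <= eta is for the update test; the other bound is for the line search, as
   (kap + al/2)^2 - (1 - al/2)^2 + 2 sigma <= 2 kap - (1 - al - 2 sigma). *)
pose kap := Num.min (eta p) ((1 - al - 2 * sigma p) / 2).
have kap0 : 0 < kap by rewrite lt_min eta0 divr_gt0//; lra.
have kap1 : kap < 1 by rewrite gt_min eta1.
have kaps : 2 * kap <= 1 - al - 2 * sigma p.
  by rewrite mulrC -ler_pdivlMr// ge_min lexx orbT.
(* Within dl of xs the Newton step is quadratic, lands in the ball where the
   residual is at most L times the distance, and satisfies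
   L C D^2 <= kap c D <= kap |H x| for the distance D. *)
pose dl := Num.min r (Num.min (Num.min 1 (r1 / C)) (kap * c / (L * C))).
have dl0 : 0 < dl by rewrite !lt_min r0 ltr01 !divr_gt0 ?mulr_gt0.
have [K hK] := dist_vanishes dl0.
pose good k := beta (s_ k) = norm2 (H (x_ k)) /\
  mxdist N (Jac (Ht ^~ (eps (s_ k))) (x_ k)) (dCH (x_ k))
      <= gamma p * norm2 (H (x_ k)).
have test_good k : test k -> good k.+1.
  move=> tk; have [_] := invariant_step (inv k) (st k) (@Hx k.+1).
  by rewrite -/(x_ _) -/(test k) tk => -[].
have local k : (K <= k)%N -> good k ->
    norm2 (x_ k.+1 - xs) <= C * norm2 (x_ k - xs) ^+ 2 /\ good k.+1.
  move=> /hK + [bE dist]; set D := norm2 _.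
  rewrite !lt_min => /andP[Dr /andP[/andP[D1 Dr1] DL]].
  have D0 : 0 <= D by exact: norm2_ge0.
  have [e0 eb gap sm] := inv k.
  have [_ [d [m [nd mE xE _]]]] := st k.
  have [w Jw w0] := Jac_Ht (x_ k) e0.
  have q : norm2 (x_ k + d - xs) <= C * D ^+ 2.
    by apply: (quad _ _ w Dr (Hx k) w0); rewrite -Jw.
  set y := x_ k + d in q.
  set a := norm2 (H (x_ k)) in bE.
  have a0 : 0 <= a by exact: norm2_ge0.
  have Da : c * D <= a by have := H_expansive (x_ k) xs; rewrite Hxs subr0.
  have Hy : norm2 (H y) <= kap * a.
    have yr : norm2 (y - xs) < r1.
      apply: le_lt_trans q _; move: Dr1; rewrite ltr_pdivlMr//.
      by rewrite expr2; nra.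
    have := calm y yr; rewrite -/H Hxs subr0 => h; apply: le_trans h _.
    move: DL; rewrite ltr_pdivlMr ?mulr_gt0// => DL.
    apply: (@le_trans _ _ (L * (C * D ^+ 2))); first by rewrite ler_pM2l.
    have h1 : D * (L * C) * D <= kap * c * D by rewrite ler_wpM2r// ltW.
    have h2 : kap * (c * D) <= kap * a by rewrite ler_pM2l.
    rewrite expr2; lra.
  have me : mu p * eps (s_ k) <= al / 2 * a by rewrite -bE.
  have Hty : norm2 (Ht y (eps (s_ k))) <= (kap + al / 2) * a.
    have := norm2_le_distD (Ht y (eps (s_ k))) (H y).
    have := Ht_near y e0; lra.
  have Htx : (1 - al / 2) * a <= norm2 (Ht (x_ k) (eps (s_ k))).
    have := norm2_le_distD (H (x_ k)) (Ht (x_ k) (eps (s_ k))).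
    have := Ht_near (x_ k) e0; rewrite norm2_distC -/a; lra.
  have dec : sufficient_decrease H Ht p (s_ k) d 0.
    rewrite decrease_norm2 /next_iterate expr0 scale1r mulr1 -/(x_ k) -/y -/a.
    have t1 : norm2 (Ht y (eps (s_ k))) ^+ 2 <= ((kap + al / 2) * a) ^+ 2.
      by rewrite ler_pXn2r ?nnegrE ?norm2_ge0// mulr_ge0//; lra.
    have t2 : ((1 - al / 2) * a) ^+ 2 <= norm2 (Ht (x_ k) (eps (s_ k))) ^+ 2.
      by rewrite ler_pXn2r ?nnegrE ?norm2_ge0// mulr_ge0//; lra.
    have t3 : (kap + al / 2) ^+ 2 <= (1 - al / 2) ^+ 2 - 2 * sigma p by nra.
    have t4 := ler_wpM2r (sqr_ge0 a) t3.
    move: t1 t2 t4; rewrite !exprMn; lra.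
  have m0 : m = 0%N.
    by case: m mE {xE} => // m [_ /(_ 0%N isT)]; rewrite dec.
  have {xE} xE : x_ k.+1 = y by rewrite /x_ xE m0 /next_iterate expr0 scale1r.
  rewrite xE; split => //; apply: test_good.
  rewrite /test /update_test xE le_max; apply/orP; left.
  apply: le_trans Hy _; rewrite bE ler_wpM2r// ge_min lexx//.
have [j Kj tj] := updates_recur K.
have allgood i : good (j.+1 + i)%N.
  elim: i => [|i IH]; first by rewrite addn0; exact: test_good.
  rewrite addnS; apply: (local _ _ IH).2.
  by rewrite (leq_trans Kj)// (leq_trans (leqnSn j)) ?leq_addr.
exists C; split => //; exists j.+1 => // k /= jk.
have := allgood (k - j.+1)%N; rewrite subnKC// => gk.
by apply: (local _ _ gk).1; rewrite (leq_trans Kj)// ltnW.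
Qed.

End InfiniteRun.
End Run.

Section ApproximationBound.
Variables (R : realType) (n : nat).

Lemma smoothing_approx_bound (A : 'M[R]_n) f (phi : 'I_n -> R -> R)
    (Ft : 'cV[R]_n -> R -> 'cV[R]_n) (psi : 'I_n -> R -> R -> R) :
  (forall x (e : R), 0 < e -> Ft x e = diag_map (fun i t => psi i t e) x) ->
  (forall i, admissible_smoothing1 (phi i) (psi i)) ->
  exists m, approx_bound (residual A (diag_map phi) f)
    (fun x e => residual A (Ft ^~ e) f x) m.
Proof.
move=> FtE sm; pose P i (m _ : R) := forall t (e : R), 0 < e ->
  `|psi i t e - phi i t| <= m * e.
have [||m [r [m0 _ Pm]]] := @uniform_over_coords R n P.
- move=> i m m' r r' mm' _ _ h t e e0; apply: le_trans (h t e e0) _.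
  by rewrite ler_wpM2r// ltW.
- move=> i; have [_ [m m0 h] _ _] := sm i.
  by exists m, 1; split => //; exact: ltW.
exists (n%:R * m + 1); split; first by rewrite ltr_wpDl// mulr_ge0.
move=> x e e0; apply: (@le_trans _ _ (n%:R * (m * e))).
  apply: norm2_le_of_coord => [|i]; first by rewrite mulr_ge0// ltW.
  rewrite /residual FtE// !mxE; set s := \sum_(j < n) _.
  by rewrite (_ : _ - _ = psi i (x i 0) e - phi i (x i 0)); [exact: Pm | ring].
by rewrite [leRHS]mulrDl mul1r mulrA lerDl ltW.
Qed.

End ApproximationBound.

Theorem theorem4p10 (R : realType) (n : nat) (A : 'M[R]_n) (f : 'cV[R]_n)
    (phi : 'I_n -> R -> R) (Ft : 'cV[R]_n -> R -> 'cV[R]_n)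
    (N : 'M[R]_n -> R)
    (symA : A^T = A) (posA : posdefmx A)
    (phi_mono : forall i, {homo phi i : x y / x <= y})
    (phi_pwC2 : forall i, piecewise_Ck 2 (phi i))
    (phi_bder : forall i, ae_bounded_derivative (phi i))
    (Ft_smoothing : admissible_smoothing phi Ft)
    (normN : is_mxnorm N) :
  let H := residual A (diag_map phi) f in
  let Ht := fun x e => residual A (Ft ^~ e) f x in
  let dCH := dC_residual A phi in
  (exists mu : R, approx_bound H Ht mu) /\
  exists xs : 'cV[R]_n,
    [/\ H xs = 0, forall x, H x = 0 -> x = xs
      & forall (p : params R) (x0 : 'cV[R]_n), admissible_params H Ht p ->
        [/\ well_defined H Ht dCH N p x0,
            forall s, reachable H Ht dCH N p x0 s ->
              H (iterate s) = 0 -> iterate s = xs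
          & forall s_ : nat -> state R n,
              infinite_run H Ht dCH N p x0 s_ ->
              (fun k => iterate (s_ k)) @ \oo --> xs /\
              exists C : R, 0 < C /\
                \forall k \near \oo,
                  norm2 (iterate (s_ k.+1) - xs)
                    <= C * norm2 (iterate (s_ k) - xs) ^+ 2]].
Proof.
move=> H Ht dCH; have [psi [FtE sm]] := Ft_smoothing.
split; first exact: (smoothing_approx_bound A f FtE sm).
have [c c0 Ac] := posdefmx_coercive posA.
have [xs Hxs] : exists xs, H xs = 0.
  apply: (residual_has_zero f c0 Ac phi_mono) => i.
    by have [] := phi_pwC2 i.
  by move=> s; exact: piecewise_C2_calm.
have uniq x : H x = 0 -> x = xs.
  move=> Hx; apply/eqP; rewrite -subr_eq0 -norm2_eq0 eq_le norm2_ge0 andbT.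
  rewrite -(pmulr_rle0 _ c0).
  rewrite (le_trans (residual_expansive f x xs Ac phi_mono))//.
  by rewrite -/H Hx Hxs subrr norm2_0.
exists xs; split => // p x0 prm; split.
- exact: (algorithm_well_defined (psi := psi) c0).
- by move=> s _; exact: uniq.
- move=> s_ run; split.
    exact: (run_converges (psi := psi) c0 Ac phi_mono FtE sm prm Hxs run).
  exact: (run_quadratic c0 Ac phi_mono phi_pwC2 FtE sm normN prm Hxs run).
Qed.
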